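(* Let $d\ge3$ and $\gamma\in[1,\frac{2d}{d+2})$, and let $\rho$ be a gaseous Lane–Emden profile (which is then defined on $[0,\infty)$) with mass function $m$. Let $\mathbf v^*=(v_1^*,v_2^* )$ with $v_1^*=\big(\frac{1}{2\pi}\frac{-d\gamma^2+2(d-1)\gamma}{(2-\gamma)^2}\big)^{1/(2-\gamma)}$ and $v_2^*=\frac{2\gamma}{2-\gamma}\big(\frac{1}{2\pi}\frac{-d\gamma^2+2(d-1)\gamma}{(2-\gamma)^2}\big)^{(\gamma-1)/(2-\gamma)}$. Then there exist constants $c>0$ and $K>0$ such that for all $r>0$, $$\big|r^{2/(2-\gamma)}\rho(r)-v_1^*\big|\le Kr^{-c},\qquad\big|r^{2/(2-\gamma)-d}m(r)-v_2^*\big|\le Kr^{-c}.$$ In particular the profile is asymptotic as $r\to\infty$ to the singular solution $v_1^*r^{-2/(2-\gamma)}$.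
   Context: Fix an integer $d\ge 3$ and $\gamma\in[1,2]$. For $\rho_0>0$, the (radial, gaseous) Lane–Emden profile with central density $\rho_0$ is the unique continuous function $\rho:[0,R_g)\to(0,\infty)$, defined on its maximal interval of existence $[0,R_g)$, $R_g\in(0,\infty]$, with $\rho(0)=\rho_0$ and, writing $m(r)=4\pi\int_0^r y^{d-1}\rho(y)\,dy$ (the mass function), $\frac{d}{dr}\big(\rho(r)^\gamma\big)=-\rho(r)\,m(r)/r^{d-1}$ for $0<r<R_g$. *)

(* Defs.v *)
From Stdlib Require Import Reals Lra.
From Coquelicot Require Import Coquelicot.
Open Scope R_scope.

Definition mass (d : nat) (rho : R -> R) (r : R) : R :=
  4 * PI * RInt (fun y => y ^ (d - 1) * rho y) 0 r.

Definition LE_solution (d : nat) (gamma rho0 : R) (Rg : Rbar) (rho : R -> R) : Prop :=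
  Rbar_lt 0 Rg /\
  rho 0 = rho0 /\
  (forall r, 0 <= r -> Rbar_lt r Rg -> 0 < rho r) /\
  (forall r, 0 <= r -> Rbar_lt r Rg ->
     filterlim rho (within (fun y => 0 <= y /\ Rbar_lt y Rg) (locally r))
               (locally (rho r))) /\
  (forall r, 0 < r -> Rbar_lt r Rg ->
     is_derive (fun s => Rpower (rho s) gamma) r
               (- (rho r * mass d rho r / r ^ (d - 1)))).

Definition LE_profile (d : nat) (gamma rho0 : R) (Rg : Rbar) (rho : R -> R) : Prop :=
  LE_solution d gamma rho0 Rg rho /\
  (forall Rg' rho', LE_solution d gamma rho0 Rg' rho' -> Rbar_le Rg' Rg).

Definition LE_A (d : nat) (gamma : R) : R :=
  / (2 * PI) * ((- INR d * gamma ^ 2 + 2 * (INR d - 1) * gamma) / (2 - gamma) ^ 2).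

Definition v1star (d : nat) (gamma : R) : R :=
  Rpower (LE_A d gamma) (1 / (2 - gamma)).

Definition v2star (d : nat) (gamma : R) : R :=
  2 * gamma / (2 - gamma) * Rpower (LE_A d gamma) ((gamma - 1) / (2 - gamma)).

(* Main.v *)
Require Import Defs.
From Stdlib Require Import Reals Lra Lia.
From Coquelicot Require Import Coquelicot.
Open Scope R_scope.

(** Put [W = - r rho' / rho]. The Pohozaev quantity
    [4 pi r^d rho^gamma + r^(2-d) m^2 / 2 - d m rho^(gamma-1)] vanishes at the origin and is
    nonincreasing exactly when [gamma <= 2d/(d+2)]; its sign gives [W <= 2d/gamma]. Hence [rho]
    stays away from [0] on bounded intervals, a local solution started just before a finite
    endpoint would continue the profile past it, and the maximal interval is infinite.

    With [al = 2/(2-gamma)], [x = al ln r + ln rho] and [y = exp((gamma-1) x) (al - W)], the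
    equation becomes, in the time [ln r], the damped Newton equation
    [x' = exp(-(gamma-1) x) y], [y' = - kappa y - force x] with [kappa = d - al gamma > 0],
    whose potential is minimal at [xs = ln v1star]. The energy traps [x] in a compact interval,
    on which the energy corrected by a small multiple of [y (x - xs)] decays exponentially in
    [ln r], that is, like a power of [r]. *)

(** * Calculus *)

(** One expression governs both halves. The derivative of the Pohozaev quantity carries the factor
    [gamma (d + 2) - 2 d], while [kappa (2 - gamma) = 2 d - gamma (d + 2)]: subcriticality bounds
    [W] and also makes the friction strictly positive. The weight [exp((gamma - 1) x)] in [y] is
    dictated by the equation for [W], which is of Riccati type with quadratic term
    [(gamma - 1) W^2]. Differentiating the weight produces [(gamma - 1) (al - W)^2], the squares
    cancel, and the friction becomes linear. The price is the factor [exp(-(gamma - 1) x)] in [x'],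
    which is under control only while [x] stays bounded. The upper bound on [x] needs no energy: the
    mass of a ball is at least that given by its boundary density, so [exp((2 - gamma) x)] is at
    most a multiple of [W]. The lower bound does use the energy, differently for [gamma = 1] and
    [gamma > 1]. Local existence is invoked only away from the origin, where the equation is not
    singular, but with a step that is uniform up to the endpoint. *)

Lemma derive_nonpos_decr (f f' : R -> R) (a b : R) :
  a <= b ->
  (forall x, a < x < b -> is_derive f x (f' x)) ->
  (forall x, a <= x <= b -> continuity_pt f x) ->
  (forall x, a < x < b -> f' x <= 0) ->
  f b <= f a.
Proof.
  intros Hab Hd Hc Hn.
  (* The mean value point may be an endpoint, where the sign of [f'] is unknown. Capping the
     derivative at [0] makes it nonpositive everywhere and changes nothing inside. *)
  destruct (MVT_gen f a b (fun x => Rmin (f' x) 0)) as [c [_ Hcc]].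
  - rewrite Rmin_left, Rmax_right by lra. intros x Hx.
    rewrite Rmin_left by (apply Hn; lra). apply Hd; lra.
  - rewrite Rmin_left, Rmax_right by lra. exact Hc.
  - pose proof (Rmin_r (f' c) 0). nra.
Qed.

(* [auto_derive] leaves [Derive] of an eta-expanded function. *)
Lemma Derive_eta (f : R -> R) (x l : R) : is_derive f x l -> Derive (fun y : R => f y) x = l.
Proof. apply (is_derive_unique f). Qed.

Lemma derive_continuity_pt (f : R -> R) (x l : R) : is_derive f x l -> continuity_pt f x.
Proof.
  intros H. apply continuity_pt_filterlim.
  apply (ex_derive_continuous f x). exists l; exact H.
Qed.

Lemma derive_nonpos_decr_closed (f f' : R -> R) (a b : R) :
  a <= b ->
  (forall x, a <= x <= b -> is_derive f x (f' x)) ->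
  (forall x, a <= x <= b -> f' x <= 0) ->
  f b <= f a.
Proof.
  intros Hab Hd Hn. apply (derive_nonpos_decr f f'); auto.
  - intros x Hx; apply Hd; lra.
  - intros x Hx. eapply derive_continuity_pt, Hd, Hx.
  - intros x Hx; apply Hn; lra.
Qed.

(** * The mass function *)

(** The profile is continuous at the origin only from the right. Composing it with the retraction
    [Rmax 0] yields a function continuous on both sides, as the integration lemmas require. *)
Lemma filterlim_Rmax0_within (Rg : Rbar) (r : R) :
  Rbar_lt 0 Rg -> Rbar_lt r Rg ->
  filterlim (Rmax 0) (locally r)
    (within (fun y => 0 <= y /\ Rbar_lt y Rg) (locally (Rmax 0 r))).
Proof.
  intros H0 Hr P [e He].
  destruct (open_Rbar_lt Rg r Hr) as [e' He'].
  assert (Hm : 0 < Rmin e e') by (apply Rmin_pos; apply cond_pos).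
  exists (mkposreal _ Hm). intros y Hy.
  assert (Hy' : Rabs (y - r) < Rmin e e') by exact Hy.
  apply He.
  - apply Rle_lt_trans with (Rabs (y - r)).
    + change (Rabs (Rmax 0 y - Rmax 0 r) <= Rabs (y - r)).
      unfold Rmax, Rabs.
      repeat destruct Rle_dec; repeat destruct Rcase_abs; lra.
    + pose proof (Rmin_l e e'); lra.
  - split; [apply Rmax_l|].
    destruct (Rle_dec 0 y).
    + rewrite Rmax_right by assumption. apply He'.
      change (Rabs (y - r) < e'). pose proof (Rmin_r e e'); lra.
    + rewrite Rmax_left by lra. exact H0.
Qed.

Section MassFunction.
Context (d : nat) (gamma rho0 : R) (Rg : Rbar) (rho : R -> R).
Context (Hd : (3 <= d)%nat) (Hg : 1 <= gamma).
Context (Hsol : LE_solution d gamma rho0 Rg rho).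

Lemma Rg_pos : Rbar_lt 0 Rg.
Proof. apply Hsol. Qed.

Lemma rho_pos (r : R) : 0 <= r -> Rbar_lt r Rg -> 0 < rho r.
Proof. apply Hsol. Qed.

Lemma lt_Rg_trans (r s : R) : r <= s -> Rbar_lt s Rg -> Rbar_lt r Rg.
Proof. intros H; apply Rbar_le_lt_trans; exact H. Qed.

Lemma rho_ext_continuous (r : R) : Rbar_lt r Rg -> continuous (fun y => rho (Rmax 0 y)) r.
Proof.
  intros Hr. unfold continuous.
  eapply filterlim_comp; [apply (filterlim_Rmax0_within Rg); [apply Rg_pos | exact Hr]|].
  apply Hsol; [apply Rmax_l|].
  destruct (Rle_dec 0 r); [rewrite Rmax_right | rewrite Rmax_left]; auto using Rg_pos; lra.
Qed.

Lemma pow_continuous (n : nat) (r : R) : continuous (fun y => y ^ n) r.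
Proof. apply (ex_derive_continuous (fun y => y ^ n)). auto_derive; trivial. Qed.

Lemma mass_density_continuous (r : R) :
  Rbar_lt r Rg -> continuous (fun y => y ^ (d - 1) * rho (Rmax 0 y)) r.
Proof.
  intros Hr. apply (continuous_mult (fun y => y ^ (d - 1))).
  - apply pow_continuous.
  - apply rho_ext_continuous, Hr.
Qed.

Lemma ex_RInt_mass_density (a b : R) :
  Rbar_lt a Rg -> Rbar_lt b Rg -> ex_RInt (fun y => y ^ (d - 1) * rho (Rmax 0 y)) a b.
Proof.
  intros Ha Hb. apply (ex_RInt_continuous (V:=R_CompleteNormedModule)).
  intros z [_ Hz]. apply mass_density_continuous.
  apply lt_Rg_trans with (Rmax a b); auto.
  unfold Rmax; destruct Rle_dec; auto.
Qed.

Lemma mass_eq (r : R) : 0 <= r ->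
  mass d rho r = 4 * PI * RInt (fun y => y ^ (d - 1) * rho (Rmax 0 y)) 0 r.
Proof.
  intros Hr. unfold mass. f_equal. apply RInt_ext.
  rewrite Rmin_left, Rmax_right by lra. intros x Hx.
  rewrite Rmax_right by lra; reflexivity.
Qed.

Lemma mass_derive (r : R) : 0 < r -> Rbar_lt r Rg ->
  is_derive (mass d rho) r (4 * PI * (r ^ (d - 1) * rho r)).
Proof.
  intros H0 Hr.
  apply (is_derive_ext_loc
           (fun s => 4 * PI * RInt (fun y => y ^ (d - 1) * rho (Rmax 0 y)) 0 s)).
  { exists (mkposreal _ H0). intros y Hy.
    symmetry; apply mass_eq.
    assert (Rabs (y - r) < r) by exact Hy.
    apply Rabs_def2 in H. lra. }
  apply is_derive_scal.
  replace (r ^ (d - 1) * rho r) with (r ^ (d - 1) * rho (Rmax 0 r)) by (rewrite Rmax_right by lra; reflexivity).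
  apply (is_derive_RInt (fun y => y ^ (d - 1) * rho (Rmax 0 y)) _ 0 r).
  - destruct (open_Rbar_lt Rg r Hr) as [e He].
    exists e. intros b Hb. apply (RInt_correct (V:=R_CompleteNormedModule)).
    apply ex_RInt_mass_density; auto using Rg_pos.
  - apply mass_density_continuous, Hr.
Qed.

Lemma lnrho_derive (r : R) : 0 < r -> Rbar_lt r Rg ->
  is_derive (fun s => ln (rho s)) r
    (- (exp ((1 - gamma) * ln (rho r)) * mass d rho r / (gamma * r ^ (d - 1)))).
Proof.
  intros H0 Hr.
  assert (Hp : 0 < rho r) by (apply rho_pos; [lra | exact Hr]).
  (* Only [rho^gamma] is given as differentiable, so [ln rho] is recovered as
     [ln (rho^gamma) / gamma]. *)
  apply (is_derive_ext (fun s => / gamma * ln (Rpower (rho s) gamma))).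
  { intros t. unfold Rpower. rewrite ln_exp.
    change (/ gamma * (gamma * ln (rho t)) = ln (rho t) :> R). field. lra. }
  evar_last.
  { apply is_derive_scal.
    apply (is_derive_comp ln (fun s => Rpower (rho s) gamma)).
    - apply is_derive_ln. apply exp_pos.
    - apply Hsol; auto. }
  unfold scal; simpl; unfold mult; simpl. unfold Rpower.
  replace ((1 - gamma) * ln (rho r)) with (ln (rho r) + - (gamma * ln (rho r))) by ring.
  rewrite exp_plus, exp_Ropp, exp_ln by exact Hp.
  assert (r ^ (d - 1) <> 0) by (apply pow_nonzero; lra).
  pose proof (exp_pos (gamma * ln (rho r))).
  field. repeat split; lra.
Qed.

Lemma mass_nonneg (r : R) : 0 <= r -> Rbar_lt r Rg -> 0 <= mass d rho r.
Proof.
  intros H0 Hr. rewrite mass_eq by exact H0.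
  apply Rmult_le_pos; [pose proof PI_RGT_0; lra|].
  apply RInt_ge_0; auto.
  - apply ex_RInt_mass_density; auto using Rg_pos.
  - intros x Hx. rewrite Rmax_right by lra. apply Rmult_le_pos.
    + apply pow_le; lra.
    + left; apply rho_pos; [lra|]. apply lt_Rg_trans with r; [lra | exact Hr].
Qed.

Lemma lnrho_ext_continuous (r : R) : Rbar_lt r Rg -> continuity_pt (fun y => ln (rho (Rmax 0 y))) r.
Proof.
  intros Hr. apply continuity_pt_filterlim.
  apply (continuous_comp (fun y => rho (Rmax 0 y)) ln).
  - apply rho_ext_continuous, Hr.
  - apply (ex_derive_continuous ln). eexists. apply is_derive_ln.
    apply rho_pos; [apply Rmax_l|].
    destruct (Rle_dec 0 r); [rewrite Rmax_right | rewrite Rmax_left]; auto using Rg_pos; lra.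
Qed.

Lemma lnrho_decr (r s : R) : 0 <= r <= s -> Rbar_lt s Rg -> ln (rho s) <= ln (rho r).
Proof.
  intros Hrs Hs.
  (* The equation says nothing at [0]; the extended function supplies the continuity there that lets
     the interval start at the origin. *)
  rewrite <- (Rmax_right 0 r) at 1 by lra. rewrite <- (Rmax_right 0 s) at 1 by lra.
  apply (derive_nonpos_decr (fun y => ln (rho (Rmax 0 y)))
    (fun r => - (exp ((1 - gamma) * ln (rho r)) * mass d rho r / (gamma * r ^ (d - 1))))).
  - lra.
  - intros x Hx.
    assert (Hxg : Rbar_lt x Rg) by (apply lt_Rg_trans with s; [lra | exact Hs]).
    apply (is_derive_ext_loc (fun s => ln (rho s))).
    + assert (H0 : 0 < x) by lra. exists (mkposreal _ H0). intros y Hy.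
      assert (Hy' : Rabs (y - x) < x) by exact Hy. apply Rabs_def2 in Hy'.
      rewrite Rmax_right by lra. reflexivity.
    + apply lnrho_derive; [lra | exact Hxg].
  - intros x Hx. apply lnrho_ext_continuous.
    apply lt_Rg_trans with s; [lra | exact Hs].
  - intros x Hx.
    assert (Hxg : Rbar_lt x Rg) by (apply lt_Rg_trans with s; [lra | exact Hs]).
    assert (0 <= exp ((1 - gamma) * ln (rho x)) * mass d rho x / (gamma * x ^ (d - 1))).
    { apply Rmult_le_pos.
      - apply Rmult_le_pos; [left; apply exp_pos | apply mass_nonneg; [lra | exact Hxg]].
      - left. apply Rinv_0_lt_compat, Rmult_lt_0_compat; [lra | apply pow_lt; lra]. }
    lra.
Qed.

Lemma rho_decr (r s : R) : 0 <= r <= s -> Rbar_lt s Rg -> rho s <= rho r.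
Proof.
  intros Hrs Hs.
  assert (Hr : Rbar_lt r Rg) by (apply lt_Rg_trans with s; [lra | exact Hs]).
  apply Rnot_lt_le. intros Hlt.
  pose proof (ln_increasing _ _ (rho_pos r (proj1 Hrs) Hr) Hlt).
  pose proof (lnrho_decr r s Hrs Hs). lra.
Qed.

Lemma RInt_monomial (c r : R) :
  RInt (fun y => y ^ (d - 1) * c) 0 r = c * r ^ d / INR d.
Proof.
  assert (HdR : 0 < INR d) by (apply lt_0_INR; lia).
  apply (is_RInt_unique (V:=R_CompleteNormedModule)).
  evar_last.
  - apply (is_RInt_derive (fun y => c * y ^ d / INR d)).
    + intros x _. auto_derive; trivial. replace (pred d) with (d - 1)%nat by lia.
      field. lra.
    + intros x _. apply (continuous_mult (fun y => y ^ (d - 1))).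
      * apply pow_continuous.
      * apply continuous_const.
  - unfold minus, plus, opp; simpl. rewrite (pow_ne_zero d) by lia. field. lra.
Qed.

Lemma ex_RInt_monomial (c r : R) : ex_RInt (fun y => y ^ (d - 1) * c) 0 r.
Proof.
  apply (ex_RInt_continuous (V:=R_CompleteNormedModule)). intros z _.
  apply (continuous_mult (fun y => y ^ (d - 1))).
  - apply pow_continuous.
  - apply continuous_const.
Qed.

Lemma mass_upper (r : R) : 0 <= r -> Rbar_lt r Rg -> mass d rho r <= 4 * PI * (rho0 * r ^ d / INR d).
Proof.
  intros H0 Hr. rewrite mass_eq by exact H0. rewrite <- RInt_monomial.
  apply Rmult_le_compat_l; [pose proof PI_RGT_0; lra|].
  apply RInt_le; auto.
  - apply ex_RInt_mass_density; auto using Rg_pos.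
  - apply ex_RInt_monomial.
  - intros x Hx. apply Rmult_le_compat_l; [apply pow_le; lra|].
    rewrite Rmax_right by lra. rewrite <- (proj1 (proj2 Hsol)).
    apply rho_decr; [lra|]. apply lt_Rg_trans with r; [lra | exact Hr].
Qed.

(** By monotonicity the density inside the ball is at least its boundary value. This inequality
    later turns the bound on [W] into an upper bound on [X]. *)
Lemma mass_lower (r : R) : 0 <= r -> Rbar_lt r Rg -> 4 * PI * (rho r * r ^ d / INR d) <= mass d rho r.
Proof.
  intros H0 Hr. rewrite mass_eq by exact H0. rewrite <- RInt_monomial.
  apply Rmult_le_compat_l; [pose proof PI_RGT_0; lra|].
  apply RInt_le; auto.
  - apply ex_RInt_monomial.
  - apply ex_RInt_mass_density; auto using Rg_pos.
  - intros x Hx. apply Rmult_le_compat_l; [apply pow_le; lra|].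
    rewrite Rmax_right by lra. apply rho_decr; [lra | exact Hr].
Qed.

Lemma mass_pos (r : R) : 0 < r -> Rbar_lt r Rg -> 0 < mass d rho r.
Proof.
  intros H0 Hr. eapply Rlt_le_trans; [|apply mass_lower; [lra | exact Hr]].
  pose proof PI_RGT_0. pose proof (rho_pos r (Rlt_le _ _ H0) Hr).
  pose proof (pow_lt r d H0). assert (0 < INR d) by (apply lt_0_INR; lia).
  apply Rmult_lt_0_compat; [lra|]. apply Rdiv_lt_0_compat; auto.
  apply Rmult_lt_0_compat; auto.
Qed.

End MassFunction.

(** * The Pohozaev bound *)

Lemma dim_ge_3 (d : nat) : (3 <= d)%nat -> 3 <= INR d.
Proof. intros Hd. replace 3 with (INR 3) by (simpl; ring). apply le_INR, Hd. Qed.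

Lemma gamma_subcritical (d : nat) (gamma : R) : (3 <= d)%nat ->
  gamma < 2 * INR d / (INR d + 2) -> gamma * (INR d + 2) < 2 * INR d.
Proof.
  intros Hd Hg2. pose proof (dim_ge_3 d Hd).
  apply Rmult_lt_compat_r with (r := INR d + 2) in Hg2; [|lra].
  unfold Rdiv in Hg2. rewrite Rmult_assoc, Rinv_l in Hg2; lra.
Qed.

Lemma gamma_lt_2 (d : nat) (gamma : R) : (3 <= d)%nat ->
  gamma < 2 * INR d / (INR d + 2) -> gamma < 2.
Proof.
  intros Hd Hg2. pose proof (dim_ge_3 d Hd). pose proof (gamma_subcritical d gamma Hd Hg2). nra.
Qed.

(** The quantity [W = - r rho' / rho], with the derivative eliminated through the equation;
    [lnrho_derive_slope] confirms the identification. *)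
Definition slope (d : nat) (gamma : R) (rho : R -> R) (r : R) : R :=
  mass d rho r * exp ((1 - gamma) * ln (rho r)) / (gamma * r ^ (d - 2)).

(** The terms [4 pi d r^(d-1) exp(gamma u)] of the first and third summands cancel, and so do the
    terms [4 pi r m exp(u)] of the first and second. Only multiples of [m^2 / r^(d-1)] survive, with
    coefficient [- (d - 2) / 2 + d (gamma - 1) / gamma]. *)
Lemma pohozaev_derive (d : nat) (gamma : R) (u m : R -> R) (r : R) :
  (3 <= d)%nat -> 1 <= gamma -> 0 < r ->
  is_derive u r (- (exp ((1 - gamma) * u r) * m r / (gamma * r ^ (d - 1)))) ->
  is_derive m r (4 * PI * (r ^ (d - 1) * exp (u r))) ->
  is_derive (fun r : R => 4 * PI * r ^ d * exp (gamma * u r) + m r ^ 2 / (2 * r ^ (d - 2))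
                      - INR d * m r * exp ((gamma - 1) * u r)) r
    (m r ^ 2 / r ^ (d - 1) * (((2 + INR d) * gamma - 2 * INR d) / (2 * gamma))).
Proof.
  intros Hd Hg Hr Hu Hm.
  destruct d as [|[|k]]; [lia | lia |].
  replace (S (S k) - 1)%nat with (S k) in * by lia.
  replace (S (S k) - 2)%nat with k in * by lia.
  assert (Hk : r ^ k <> 0) by (apply pow_nonzero; lra).
  auto_derive.
  - repeat split; try (eexists; eassumption). nra.
  - rewrite (Derive_eta u r _ Hu), (Derive_eta m r _ Hm).
    replace (exp (gamma * u r)) with (exp (u r) * exp ((gamma - 1) * u r))
      by (rewrite <- exp_plus; f_equal; ring).
    replace ((1 - gamma) * u r) with (- ((gamma - 1) * u r)) by ring.
    rewrite exp_Ropp.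
    pose proof (exp_pos ((gamma - 1) * u r)).
    rewrite !S_INR. simpl pred. simpl (r ^ S _).
    replace (match k with 0%nat => 1 | S _ => INR k + 1 end) with (INR k + 1)
      by (destruct k; simpl; ring).
    (* Dividing by [r] removes the predecessor; for [k = 0] both sides vanish. *)
    replace (INR k * r ^ pred k) with (INR k * r ^ k / r).
    2:{ destruct k; simpl pred; [simpl; field; lra |]. simpl (r ^ S k). field. lra. }
    field. repeat split; lra.
Qed.

Section Pohozaev.
Context (d : nat) (gamma rho0 : R) (Rg : Rbar) (rho : R -> R).
Context (Hd : (3 <= d)%nat) (Hg : 1 <= gamma) (Hg2 : gamma < 2 * INR d / (INR d + 2)).
Context (Hsol : LE_solution d gamma rho0 Rg rho).

(** The vanishing at the origin is used in the form [Q s <= C * s] for small [s]; monotonicity gives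
    [Q r <= Q s], and [s] is then sent to [0]. *)
Lemma pohozaev_nonpos (r : R) : 0 < r -> Rbar_lt r Rg ->
  4 * PI * r ^ d * exp (gamma * ln (rho r)) + mass d rho r ^ 2 / (2 * r ^ (d - 2))
    - INR d * mass d rho r * exp ((gamma - 1) * ln (rho r)) <= 0.
Proof.
  intros Hr HrR.
  set (Q := fun r : R => 4 * PI * r ^ d * exp (gamma * ln (rho r))
    + mass d rho r ^ 2 / (2 * r ^ (d - 2))
    - INR d * mass d rho r * exp ((gamma - 1) * ln (rho r))).
  change (Q r <= 0).
  assert (HPI := PI_RGT_0).
  pose proof (dim_ge_3 d Hd) as HdR.
  assert (Hr0 : 0 < rho0).
  { rewrite <- (proj1 (proj2 Hsol)). apply (rho_pos d gamma rho0 Rg); auto; [lra|].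
    apply (Rg_pos d gamma rho0 Rg rho Hsol). }
  assert (Hlt : forall x : R, x <= r -> Rbar_lt x Rg).
  { intros x Hx. apply lt_Rg_trans with r; auto. }
  assert (Hmono : forall s : R, 0 < s <= r -> Q r <= Q s).
  { intros s Hs.
    apply (derive_nonpos_decr_closed Q (fun r : R => mass d rho r ^ 2 / r ^ (d - 1) *
       (((2 + INR d) * gamma - 2 * INR d) / (2 * gamma)))); [lra| |].
    - intros x Hx. apply (pohozaev_derive d gamma (fun r : R => ln (rho r)) (mass d rho)); auto; [lra| |].
      + apply (lnrho_derive d gamma rho0 Rg); auto; [lra | apply Hlt; lra].
      + rewrite exp_ln by (apply (rho_pos d gamma rho0 Rg rho Hsol); [lra | apply Hlt; lra]).
        apply (mass_derive d gamma rho0 Rg); auto; [lra | apply Hlt; lra].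
    - intros x Hx.
      assert (0 <= mass d rho x ^ 2 / x ^ (d - 1)).
      { apply Rmult_le_pos; [apply pow2_ge_0 | left; apply Rinv_0_lt_compat, pow_lt; lra]. }
      pose proof (gamma_subcritical d gamma Hd Hg2).
      assert (((2 + INR d) * gamma - 2 * INR d) / (2 * gamma) <= 0).
      { apply Rmult_le_0_r; [lra | left; apply Rinv_0_lt_compat; lra]. }
      nra. }
  (* [C] collects the first two summands, estimated with [rho <= rho0], [mass_upper] and [s^d <= s].
     The third is nonpositive and is dropped. *)
  set (C := 4 * PI * Rpower rho0 gamma + (4 * PI * (rho0 / INR d)) ^ 2 / 2).
  assert (HC : 0 < C).
  { apply Rplus_lt_le_0_compat; [apply Rmult_lt_0_compat; [lra | apply exp_pos]|].
    apply Rmult_le_pos; [apply pow2_ge_0 | lra]. }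
  assert (Hsmall : forall s : R, 0 < s -> s <= 1 -> s <= r -> Q s <= C * s).
  { intros s Hs Hs1 Hsr.
    assert (Hrs := rho_pos d gamma rho0 Rg rho Hsol s (Rlt_le _ _ Hs) (Hlt s Hsr)).
    assert (Hrs0 : rho s <= rho0).
    { rewrite <- (proj1 (proj2 Hsol)). apply (rho_decr d gamma rho0 Rg); auto; lra. }
    assert (Hms := mass_upper d gamma rho0 Rg rho Hd Hg Hsol s (Rlt_le _ _ Hs) (Hlt s Hsr)).
    assert (Hm0 := mass_nonneg d gamma rho0 Rg rho Hsol s (Rlt_le _ _ Hs) (Hlt s Hsr)).
    assert (Hsd : s ^ d <= s).
    { replace d with (S (d - 1)) by lia. simpl.
      assert (s ^ (d - 1) <= 1) by (rewrite <- (pow1 (d - 1)); apply pow_incr; lra).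
      assert (0 < s ^ (d - 1)) by (apply pow_lt; lra). nra. }
    unfold Q.
    assert (H1 : 4 * PI * s ^ d * exp (gamma * ln (rho s)) <= 4 * PI * Rpower rho0 gamma * s).
    { assert (exp (gamma * ln (rho s)) <= Rpower rho0 gamma).
      { apply Rle_Rpower_l; lra. }
      assert (0 < exp (gamma * ln (rho s))) by apply exp_pos.
      assert (0 < s ^ d) by (apply pow_lt; lra).
      replace (4 * PI * Rpower rho0 gamma * s) with (4 * PI * (s * Rpower rho0 gamma)) by ring.
      rewrite Rmult_assoc. apply Rmult_le_compat_l; [lra|].
      apply Rmult_le_compat; lra. }
    assert (H2 : mass d rho s ^ 2 / (2 * s ^ (d - 2)) <= (4 * PI * (rho0 / INR d)) ^ 2 / 2 * s).
    { assert (mass d rho s ^ 2 <= (4 * PI * (rho0 / INR d) * s ^ d) ^ 2).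
      { apply pow_incr. split; [exact Hm0|].
        replace (4 * PI * (rho0 / INR d) * s ^ d) with (4 * PI * (rho0 * s ^ d / INR d)) by (field; lra).
        exact Hms. }
      apply Rle_trans with ((4 * PI * (rho0 / INR d) * s ^ d) ^ 2 / (2 * s ^ (d - 2))).
      { apply Rmult_le_compat_r; [|assumption].
        left; apply Rinv_0_lt_compat, Rmult_lt_0_compat; [lra | apply pow_lt; lra]. }
      replace ((4 * PI * (rho0 / INR d) * s ^ d) ^ 2 / (2 * s ^ (d - 2))) with
        ((4 * PI * (rho0 / INR d)) ^ 2 / 2 * (s ^ d * s ^ 2)).
      2:{ replace (s ^ d) with (s ^ (d - 2) * s ^ 2) by (rewrite <- pow_add; f_equal; lia).
          assert (s ^ (d - 2) <> 0) by (apply pow_nonzero; lra).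
          field. split; lra. }
      apply Rmult_le_compat_l.
      - apply Rmult_le_pos; [apply pow2_ge_0 | lra].
      - assert (0 < s ^ d) by (apply pow_lt; lra). nra. }
    assert (0 <= INR d * mass d rho s * exp ((gamma - 1) * ln (rho s))).
    { apply Rmult_le_pos; [apply Rmult_le_pos; lra | left; apply exp_pos]. }
    unfold C. lra. }
  apply Rnot_lt_le. intros Hpos.
  (* With this choice [C * s <= Q r / 2], which contradicts [Q r <= Q s <= C * s] when [Q r] is
     positive. *)
  set (s := Rmin (Rmin 1 r) (Q r / (2 * C))).
  assert (0 < s).
  { unfold s. repeat apply Rmin_pos; try lra. apply Rdiv_lt_0_compat; lra. }
  assert (s <= Rmin 1 r /\ s <= Q r / (2 * C)) as [Ha Hb].
  { split; [apply Rmin_l | apply Rmin_r]. }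
  pose proof (Rmin_l 1 r). pose proof (Rmin_r 1 r).
  assert (Q s <= C * s) by (apply Hsmall; lra).
  assert (Q r <= Q s) by (apply Hmono; lra).
  assert (C * s <= Q r / 2).
  { apply Rle_trans with (C * (Q r / (2 * C))); [apply Rmult_le_compat_l; lra|].
    right; field; lra. }
  lra.
Qed.

(** Dropping the positive first term of the Pohozaev quantity and dividing by [m / (2 p)] leaves
    [m <= 2 d e p], which is the bound on the slope. *)
Lemma slope_le (r : R) : 0 < r -> Rbar_lt r Rg -> slope d gamma rho r <= 2 * INR d / gamma.
Proof.
  intros Hr HrR. pose proof (pohozaev_nonpos r Hr HrR) as HQ.
  pose proof (mass_pos d gamma rho0 Rg rho Hd Hg Hsol r Hr HrR) as Hm.
  assert (0 <= 4 * PI * r ^ d * exp (gamma * ln (rho r))).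
  { pose proof PI_RGT_0. pose proof (pow_lt r d Hr).
    pose proof (exp_pos (gamma * ln (rho r))).
    apply Rmult_le_pos; [apply Rmult_le_pos|]; lra. }
  unfold slope.
  assert (Hp := pow_lt r (d - 2) Hr).
  set (p := r ^ (d - 2)) in *. set (m := mass d rho r) in *.
  replace ((1 - gamma) * ln (rho r)) with (- ((gamma - 1) * ln (rho r))) by ring.
  rewrite exp_Ropp.
  assert (He := exp_pos ((gamma - 1) * ln (rho r))).
  set (e := exp ((gamma - 1) * ln (rho r))) in *.
  assert (H1 : m ^ 2 / (2 * p) <= INR d * m * e) by lra.
  assert (H2 : m <= 2 * INR d * e * p).
  { apply Rmult_le_reg_l with (m / (2 * p)).
    - apply Rdiv_lt_0_compat; lra.
    - replace (m / (2 * p) * m) with (m ^ 2 / (2 * p)) by (field; lra).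
      replace (m / (2 * p) * (2 * INR d * e * p)) with (INR d * m * e) by (field; lra).
      exact H1. }
  replace (m * / e / (gamma * p)) with (m * (/ e * / (gamma * p))) by (field; lra).
  replace (2 * INR d / gamma) with (2 * INR d * e * p * (/ e * / (gamma * p))) by (field; lra).
  apply Rmult_le_compat_r; [|exact H2].
  apply Rmult_le_pos; left; apply Rinv_0_lt_compat; [lra|]. apply Rmult_lt_0_compat; lra.
Qed.

Lemma slope_pos (r : R) : 0 < r -> Rbar_lt r Rg -> 0 < slope d gamma rho r.
Proof.
  intros Hr HrR. unfold slope. apply Rdiv_lt_0_compat.
  - apply Rmult_lt_0_compat; [|apply exp_pos].
    apply (mass_pos d gamma rho0 Rg); auto.
  - apply Rmult_lt_0_compat; [lra | apply pow_lt, Hr].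
Qed.

Lemma lnrho_derive_slope (r : R) : 0 < r -> Rbar_lt r Rg ->
  is_derive (fun s => ln (rho s)) r (- slope d gamma rho r / r).
Proof.
  intros Hr HrR. evar_last; [apply (lnrho_derive d gamma rho0 Rg); auto|].
  unfold slope. replace (r ^ (d - 1)) with (r ^ (d - 2) * r).
  - field. repeat split; try lra. apply pow_nonzero; lra.
  - replace (d - 1)%nat with (S (d - 2)) by lia. simpl. ring.
Qed.

(** By [slope_le] the function [ln rho + (2 d / gamma) ln r] is nondecreasing. Decay is thus at most
    a power of [r], and [rho] cannot tend to [0] at a finite radius. *)
Lemma lnrho_lower (a r : R) : 0 < a <= r -> Rbar_lt r Rg ->
  ln (rho a) - 2 * INR d / gamma * (ln r - ln a) <= ln (rho r).
Proof.
  intros Har Hr.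
  assert (Hlt : forall x : R, x <= r -> Rbar_lt x Rg) by (intros x Hx; apply lt_Rg_trans with r; auto).
  enough (- (ln (rho r) + 2 * INR d / gamma * ln r) <= - (ln (rho a) + 2 * INR d / gamma * ln a)) by lra.
  apply (derive_nonpos_decr_closed (fun r : R => - (ln (rho r) + 2 * INR d / gamma * ln r))
    (fun r : R => - ((2 * INR d / gamma - slope d gamma rho r) / r))); [lra| |].
  - intros x Hx.
    assert (Haux : forall (u : R -> R) (l c : R), is_derive u x l ->
              is_derive (fun r : R => - (u r + c * ln r)) x (- (l + c / x))).
    { intros u l c Hu. auto_derive.
      - repeat split; [eexists; exact Hu | lra].
      - rewrite (Derive_eta u x _ Hu). field. lra. }
    evar_last; [apply Haux, lnrho_derive_slope; [lra | apply Hlt; lra]|].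
    simpl. field. lra.
  - intros x Hx. pose proof (slope_le x ltac:(lra) (Hlt x ltac:(lra))).
    assert (0 <= (2 * INR d / gamma - slope d gamma rho x) / x).
    { apply Rmult_le_pos; [lra | left; apply Rinv_0_lt_compat; lra]. }
    lra.
Qed.

End Pohozaev.

(** * Local existence *)

Lemma half_pow_small (B e : R) : 0 <= B -> 0 < e -> exists N, forall n, (N <= n)%nat -> B * (1 / 2) ^ n < e.
Proof.
  intros HB He.
  destruct (pow_lt_1_zero (1 / 2)) with (y := e / (B + 1)) as [N HN].
  - rewrite Rabs_pos_eq; lra.
  - apply Rdiv_lt_0_compat; lra.
  - exists N. intros n Hn. specialize (HN n Hn).
    assert (0 < (1 / 2) ^ n) by (apply pow_lt; lra).
    rewrite Rabs_pos_eq in HN by lra.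
    apply Rle_lt_trans with ((B + 1) * (1 / 2) ^ n); [nra|].
    apply Rlt_le_trans with ((B + 1) * (e / (B + 1))); [apply Rmult_lt_compat_l; lra|].
    right; field; lra.
Qed.

(** Banach's fixed point theorem for the uniform distance, with ratio [1/2]. That distance may be
    infinite between continuous functions on the line, so the bound [B] on the first displacement is
    what makes the iterates uniformly Cauchy. *)
Lemma contraction_fixpoint (T : (R -> R) -> R -> R) (u0 : R -> R) (B : R) :
  (forall u, (forall x, continuous u x) -> forall x, continuous (T u) x) ->
  (forall u v e, (forall x, continuous u x) -> (forall x, continuous v x) ->
    (forall x, Rabs (u x - v x) <= e) -> forall x, Rabs (T u x - T v x) <= e / 2) ->
  (forall x, continuous u0 x) ->
  (forall x, Rabs (T u0 x - u0 x) <= B) ->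
  exists u, (forall x, continuous u x) /\ forall x, T u x = u x.
Proof.
  intros Tc Tk u0c HB.
  set (un := fun n => Nat.iter n T u0).
  assert (B0 : 0 <= B) by (specialize (HB 0); pose proof (Rabs_pos (T u0 0 - u0 0)); lra).
  assert (unc : forall n x, continuous (un n) x).
  { induction n; [exact u0c | simpl; apply Tc, IHn]. }
  assert (step : forall n x, Rabs (un (S n) x - un n x) <= B * (1 / 2) ^ n).
  { induction n; intros x.
    - simpl. rewrite Rmult_1_r. apply HB.
    - replace (B * (1 / 2) ^ S n) with (B * (1 / 2) ^ n / 2) by (simpl; field).
      apply (Tk (un (S n)) (un n)); auto. }
  (* Keeping the exact partial geometric sum is what lets the induction on [k] close; [geo'] then
     forgets the last factor. *)
  assert (geo : forall n k x, Rabs (un (k + n)%nat x - un n x) <= 2 * B * (1 / 2) ^ n * (1 - (1 / 2) ^ k)).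
  { induction k; intros x.
    - simpl. rewrite Rminus_diag, Rabs_R0. lra.
    - replace (un (S k + n)%nat x - un n x) with
        ((un (S (k + n))%nat x - un (k + n)%nat x) + (un (k + n)%nat x - un n x)) by (simpl; ring).
      eapply Rle_trans; [apply Rabs_triang|].
      specialize (IHk x). pose proof (step (k + n)%nat x) as H. rewrite pow_add in H.
      simpl pow. lra. }
  assert (geo' : forall n k x, Rabs (un (k + n)%nat x - un n x) <= 2 * B * (1 / 2) ^ n).
  { intros n k x. eapply Rle_trans; [apply geo|].
    assert (0 < (1 / 2) ^ n) by (apply pow_lt; lra).
    assert (0 < (1 / 2) ^ k) by (apply pow_lt; lra).
    assert (0 <= 2 * B * (1 / 2) ^ n) by (apply Rmult_le_pos; lra). nra. }
  assert (lim : forall x, is_lim_seq (fun n => un n x) (real (Lim_seq (fun n => un n x)))).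
  { intros x. apply Lim_seq_correct'. apply ex_lim_seq_cauchy_corr.
    intros e.
    destruct (half_pow_small (4 * B) e) as [N HN]; [lra | apply cond_pos |].
    exists N. intros n m Hn Hm. specialize (HN N (le_n N)).
    pose proof (geo' N (n - N)%nat x) as H1. pose proof (geo' N (m - N)%nat x) as H2.
    rewrite Nat.sub_add in H1, H2 by assumption.
    replace (un n x - un m x) with ((un n x - un N x) - (un m x - un N x)) by ring.
    eapply Rle_lt_trans; [apply Rabs_triang|]. rewrite Rabs_Ropp. lra. }
  set (u := fun x => real (Lim_seq (fun n => un n x))).
  assert (unif : forall n x, Rabs (un n x - u x) <= 2 * B * (1 / 2) ^ n).
  { intros n x.
    assert (H : is_lim_seq (fun k => Rabs (un n x - un (k + n)%nat x)) (Rabs (un n x - u x))).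
    { apply (is_lim_seq_abs _ (Finite (un n x - u x))).
      apply is_lim_seq_minus'; [apply is_lim_seq_const|].
      apply (is_lim_seq_incr_n (fun k => un k x) n). apply lim. }
    apply (is_lim_seq_le (fun k => Rabs (un n x - un (k + n)%nat x)) (fun _ => 2 * B * (1 / 2) ^ n)
      (Finite (Rabs (un n x - u x))) (Finite (2 * B * (1 / 2) ^ n))).
    - intros k. rewrite Rabs_minus_sym. apply geo'.
    - exact H.
    - apply is_lim_seq_const. }
  assert (uc : forall x, continuous u x).
  { intros x. apply continuity_pt_filterlim.
    apply (CVU_continuity un u x (mkposreal 1 Rlt_0_1)).
    - intros e He. destruct (half_pow_small (2 * B) e) as [N HN]; [lra | exact He |].
      exists N. intros n y Hn _. rewrite Rabs_minus_sym.
      eapply Rle_lt_trans; [apply unif | apply HN, Hn].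
    - intros n y _. apply continuity_pt_filterlim, unc.
    - unfold Boule; simpl. rewrite Rminus_diag, Rabs_R0. lra. }
  exists u. split; [exact uc|]. intros x.
  apply Rminus_diag_uniq. apply Rabs_eq_0. apply Rle_antisym; [|apply Rabs_pos].
  apply le_epsilon. intros e He.
  destruct (half_pow_small (2 * B) e) as [N HN]; [lra | exact He |].
  specialize (HN N (le_n N)).
  assert (H1 : Rabs (T u x - un (S N) x) <= 2 * B * (1 / 2) ^ N / 2).
  { apply (Tk u (un N)); auto. intros y. rewrite Rabs_minus_sym. apply unif. }
  pose proof (unif (S N) x) as H2.
  replace (T u x - u x) with ((T u x - un (S N) x) + (un (S N) x - u x)) by ring.
  eapply Rle_trans; [apply Rabs_triang|]. simpl pow in H2. lra.
Qed.

Lemma glue_derive (f g : R -> R) (a l : R) :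
  is_derive f a l -> is_derive g a l -> f a = g a ->
  is_derive (fun x => if Rle_dec x a then f x else g x) a l.
Proof.
  intros Hf Hg Hfg. apply is_derive_Reals in Hf, Hg. apply is_derive_Reals.
  intros e He. destruct (Hf e He) as [df Hdf], (Hg e He) as [dg Hdg].
  assert (Hm : 0 < Rmin df dg) by (apply Rmin_pos; apply cond_pos).
  exists (mkposreal _ Hm). simpl. intros h Hh0 Hh.
  destruct (Rle_dec a a); [|lra].
  pose proof (Rmin_l df dg). pose proof (Rmin_r df dg).
  destruct (Rle_dec (a + h) a).
  - apply Hdf; auto; lra.
  - rewrite Hfg. apply Hdg; auto; lra.
Qed.

Definition clamp (lo hi x : R) : R := Rmax lo (Rmin hi x).

Lemma clamp_lipschitz lo hi x y : Rabs (clamp lo hi x - clamp lo hi y) <= Rabs (x - y).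
Proof.
  unfold clamp, Rmax, Rmin, Rabs.
  repeat destruct Rle_dec; repeat destruct Rcase_abs; lra.
Qed.

Lemma clamp_bounds lo hi x : lo <= hi -> lo <= clamp lo hi x <= hi.
Proof. intros H. unfold clamp, Rmax, Rmin. repeat destruct Rle_dec; lra. Qed.

Lemma clamp_id lo hi x : lo <= x <= hi -> clamp lo hi x = x.
Proof. intros H. unfold clamp, Rmax, Rmin. repeat destruct Rle_dec; lra. Qed.

Lemma clamp_continuous lo hi x : continuous (clamp lo hi) x.
Proof.
  intros P [e He]. exists e. intros y Hy. apply He.
  change (Rabs (clamp lo hi y - clamp lo hi x) < e).
  eapply Rle_lt_trans; [apply clamp_lipschitz | exact Hy].
Qed.

Lemma exp_le_compat (x y : R) : x <= y -> exp x <= exp y.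
Proof. intros [H | ->]; [left; apply exp_increasing, H | right; reflexivity]. Qed.

Lemma exp_scaled_bound (k p Lam : R) : Rabs k <= 1 -> Rabs p <= Lam -> exp (k * p) <= exp Lam.
Proof.
  intros Hk Hp.
  apply exp_le_compat.
  apply Rle_trans with (Rabs (k * p)); [apply Rle_abs|]. rewrite Rabs_mult.
  pose proof (Rabs_pos k). pose proof (Rabs_pos p). nra.
Qed.

Lemma exp_scaled_lipschitz (k p q Lam : R) :
  Rabs k <= 1 -> Rabs p <= Lam -> Rabs q <= Lam ->
  Rabs (exp (k * p) - exp (k * q)) <= exp Lam * Rabs (p - q).
Proof.
  intros Hk Hp Hq.
  destruct (MVT_gen (fun x => exp (k * x)) q p (fun x => k * exp (k * x))) as [c [Hc ->]].
  - intros x _. auto_derive; trivial. ring.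
  - intros x _. apply derive_continuity_pt with (k * exp (k * x)). auto_derive; trivial. ring.
  - rewrite Rabs_mult. apply Rmult_le_compat_r; [apply Rabs_pos|].
    rewrite Rabs_mult, (Rabs_pos_eq (exp _)) by (left; apply exp_pos).
    assert (exp (k * c) <= exp Lam).
    { apply exp_scaled_bound; [exact Hk|]. revert Hc Hp Hq.
      unfold Rmin, Rmax, Rabs. repeat destruct Rle_dec; repeat destruct Rcase_abs; lra. }
    pose proof (exp_pos (k * c)). pose proof (Rabs_pos k). nra.
Qed.

(** * Truncated Picard operator for [u = ln rho] *)

Section Picard.
Context (d : nat) (gamma a b Lam M : R).
Context (Hg : 1 <= gamma <= 2) (Hab : 0 < a <= b) (HL : 0 <= Lam) (HM : 0 <= M).

(* The truncation makes the integral operator globally Lipschitz; it is inactive on the solution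
   found, which stays within [1] of its initial value. *)
Let cut (x : R) := clamp (- (Lam + 1)) (Lam + 1) x.
(** [E] bounds the truncated exponentials and their Lipschitz constants. [D] does the same for the
    mass gained over a unit interval, and [den] is the least denominator to the right of [a]. Then
    [B1] bounds the right-hand side and [B2] is its Lipschitz constant. *)
Let E := exp (Lam + 1).
Let D := 4 * PI * ((b + 1) ^ (d - 1) * E).
Let den := gamma * a ^ (d - 1).
Let B1 := E * (M + D) / den.
Let B2 := (E * (M + D) + E * D) / den.

(** Integrating the density from the initial mass makes the second-order equation a first-order
    nonlocal one for [u]. The factor [1] gives the integrand the shape [exp (k * _)] of the
    prefactor in [picard_rhs], so the same estimates serve both. *)
Definition picard_mass (s0 m0 : R) (u : R -> R) (s : R) : R :=
  m0 + 4 * PI * RInt (fun y => y ^ (d - 1) * exp (1 * cut (u y))) s0 s.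
Definition picard_rhs (s0 m0 : R) (u : R -> R) (s : R) : R :=
  exp ((1 - gamma) * cut (u s)) * picard_mass s0 m0 u s / (gamma * s ^ (d - 1)).

Lemma cut_bound (x : R) : Rabs (cut x) <= Lam + 1.
Proof. apply Rabs_le, clamp_bounds. lra. Qed.

Lemma picard_density_continuous (k : R) (u : R -> R) (y : R) :
  (forall x, continuous u x) -> continuous (fun y => exp (k * cut (u y))) y.
Proof.
  intros Hu.
  apply (continuous_comp (fun y => cut (u y)) (fun z => exp (k * z))).
  - apply (continuous_comp u cut); [apply Hu | apply clamp_continuous].
  - apply (ex_derive_continuous (fun z => exp (k * z))). auto_derive; trivial.
Qed.

Lemma picard_integrand_continuous (u : R -> R) (y : R) :
  (forall x, continuous u x) -> continuous (fun y => y ^ (d - 1) * exp (1 * cut (u y))) y.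
Proof.
  intros Hu. apply (continuous_mult (fun y => y ^ (d - 1))).
  - apply pow_continuous.
  - apply picard_density_continuous, Hu.
Qed.

Lemma ex_RInt_picard_integrand (u : R -> R) (x : R) (y : R) : (forall x, continuous u x) ->
  ex_RInt (fun y => y ^ (d - 1) * exp (1 * cut (u y))) x y.
Proof.
  intros Hu. apply (ex_RInt_continuous (V:=R_CompleteNormedModule)).
  intros z _. apply picard_integrand_continuous, Hu.
Qed.

Lemma picard_mass_continuous (s0 : R) (m0 : R) (u : R -> R) (s : R) : (forall x, continuous u x) ->
  continuous (picard_mass s0 m0 u) s.
Proof.
  intros Hu. unfold picard_mass.
  apply (continuous_plus (fun _ : R => m0)); [apply continuous_const|].
  apply (continuous_scal_r (4 * PI) (fun s => RInt (fun y => y ^ (d - 1) * exp (1 * cut (u y))) s0 s)).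
  apply (ex_derive_continuous (fun s => RInt (fun y => y ^ (d - 1) * exp (1 * cut (u y))) s0 s)). eexists.
  apply (is_derive_RInt (fun y => y ^ (d - 1) * exp (1 * cut (u y))) _ s0).
  - exists (mkposreal 1 Rlt_0_1). intros z _. apply (RInt_correct (V:=R_CompleteNormedModule)).
    apply ex_RInt_picard_integrand, Hu.
  - apply picard_integrand_continuous, Hu.
Qed.

Lemma picard_rhs_continuous (s0 : R) (m0 : R) (u : R -> R) (s : R) : (forall x, continuous u x) -> 0 < s ->
  continuous (picard_rhs s0 m0 u) s.
Proof.
  intros Hu Hs. unfold picard_rhs.
  apply (continuous_mult (fun s => exp ((1 - gamma) * cut (u s)) * picard_mass s0 m0 u s)
    (fun s => / (gamma * s ^ (d - 1)))).
  - apply (continuous_mult (fun s => exp ((1 - gamma) * cut (u s)))).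
    + apply picard_density_continuous, Hu.
    + apply picard_mass_continuous, Hu.
  - apply (ex_derive_continuous (fun s => / (gamma * s ^ (d - 1)))). auto_derive.
    apply Rmult_integral_contrapositive_currified; [lra|].
    apply pow_nonzero; lra.
Qed.

Lemma ex_RInt_picard_rhs (s0 : R) (m0 : R) (u : R -> R) (s : R) : (forall x, continuous u x) -> 0 < s0 -> 0 < s ->
  ex_RInt (picard_rhs s0 m0 u) s0 s.
Proof.
  intros Hu H0 Hs. apply (ex_RInt_continuous (V:=R_CompleteNormedModule)).
  intros z [Hz _]. apply picard_rhs_continuous; [exact Hu|].
  pose proof (Rmin_pos s0 s H0 Hs). lra.
Qed.

Lemma picard_rhs_derive (s0 : R) (m0 : R) (u : R -> R) (s : R) : (forall x, continuous u x) -> 0 < s0 -> 0 < s ->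
  is_derive (fun s => RInt (picard_rhs s0 m0 u) s0 s) s (picard_rhs s0 m0 u s).
Proof.
  intros Hu H0 Hs.
  apply (is_derive_RInt (picard_rhs s0 m0 u) _ s0).
  - exists (mkposreal s Hs). intros z Hz. apply (RInt_correct (V:=R_CompleteNormedModule)).
    apply ex_RInt_picard_rhs; auto.
    assert (Hz' : Rabs (z - s) < s) by exact Hz. apply Rabs_def2 in Hz'. lra.
  - apply picard_rhs_continuous; auto.
Qed.

Lemma E_pos : 0 < E.
Proof. apply exp_pos. Qed.

Lemma D_nonneg : 0 <= D.
Proof.
  pose proof PI_RGT_0. pose proof E_pos.
  apply Rmult_le_pos; [lra|]. apply Rmult_le_pos; [apply pow_le; lra | lra].
Qed.

Lemma den_pos : 0 < den.
Proof. apply Rmult_lt_0_compat; [lra | apply pow_lt; lra]. Qed.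

Lemma B1_nonneg : 0 <= B1.
Proof.
  pose proof E_pos. pose proof D_nonneg. pose proof den_pos.
  apply Rmult_le_pos; [apply Rmult_le_pos; lra | left; apply Rinv_0_lt_compat; lra].
Qed.

Lemma B2_nonneg : 0 <= B2.
Proof.
  pose proof E_pos. pose proof D_nonneg. pose proof den_pos.
  apply Rmult_le_pos; [|left; apply Rinv_0_lt_compat; lra].
  apply Rplus_le_le_0_compat; apply Rmult_le_pos; lra.
Qed.

Section Initial.
Context (s0 m0 : R) (Hs0 : a <= s0 <= b) (Hm0 : 0 <= m0 <= M).

Lemma picard_mass_bound (u : R -> R) (s : R) : (forall x, continuous u x) -> s0 <= s <= s0 + 1 ->
  Rabs (picard_mass s0 m0 u s) <= M + D.
Proof.
  intros Hu Hs. unfold picard_mass.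
  eapply Rle_trans; [apply Rabs_triang|].
  apply Rplus_le_compat; [rewrite Rabs_pos_eq; lra|].
  pose proof PI_RGT_0.
  rewrite Rabs_mult, (Rabs_pos_eq (4 * PI)) by lra.
  apply Rmult_le_compat_l; [lra|].
  assert (HF : Rabs (RInt (fun y => y ^ (d - 1) * exp (1 * cut (u y))) s0 s)
     <= (s - s0) * ((b + 1) ^ (d - 1) * E)).
  { apply abs_RInt_le_const; [lra | apply ex_RInt_picard_integrand, Hu|].
    intros t Ht. rewrite Rabs_mult, (Rabs_pos_eq (exp _)) by (left; apply exp_pos).
    apply Rmult_le_compat; [apply Rabs_pos | left; apply exp_pos | |].
    - rewrite Rabs_pos_eq by (apply pow_le; lra). apply pow_incr; lra.
    - apply exp_scaled_bound; [rewrite Rabs_R1; lra | apply cut_bound]. }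
  assert (0 <= (b + 1) ^ (d - 1) * E).
  { pose proof E_pos. apply Rmult_le_pos; [apply pow_le|]; lra. }
  nra.
Qed.

Lemma picard_mass_lipschitz (u : R -> R) (v : R -> R) (e : R) (s : R) :
  (forall x, continuous u x) -> (forall x, continuous v x) ->
  (forall x, Rabs (u x - v x) <= e) -> s0 <= s <= s0 + 1 ->
  Rabs (picard_mass s0 m0 u s - picard_mass s0 m0 v s) <= D * e.
Proof.
  intros Hu Hv He Hs. unfold picard_mass.
  assert (0 <= e) by (specialize (He 0); pose proof (Rabs_pos (u 0 - v 0)); lra).
  replace (_ - _) with (4 * PI * (RInt (fun y => y ^ (d - 1) * exp (1 * cut (u y))) s0 s
     - RInt (fun y => y ^ (d - 1) * exp (1 * cut (v y))) s0 s)) by ring.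
  pose proof PI_RGT_0.
  rewrite Rabs_mult, (Rabs_pos_eq (4 * PI)) by lra. unfold D.
  replace (4 * PI * ((b + 1) ^ (d - 1) * E) * e) with (4 * PI * ((b + 1) ^ (d - 1) * E * e)) by ring.
  apply Rmult_le_compat_l; [lra|].
  change (Rabs (minus (RInt (fun y => y ^ (d - 1) * exp (1 * cut (u y))) s0 s)
     (RInt (fun y => y ^ (d - 1) * exp (1 * cut (v y))) s0 s)) <= (b + 1) ^ (d - 1) * E * e).
  rewrite <- (RInt_minus (V:=R_CompleteNormedModule)) by (apply ex_RInt_picard_integrand; assumption).
  assert (HF : Rabs (RInt (fun y => minus (y ^ (d - 1) * exp (1 * cut (u y)))
       (y ^ (d - 1) * exp (1 * cut (v y)))) s0 s)
     <= (s - s0) * ((b + 1) ^ (d - 1) * (E * e))).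
  { apply abs_RInt_le_const; [lra | |].
    - apply (ex_RInt_minus (V:=R_CompleteNormedModule)); apply ex_RInt_picard_integrand; assumption.
    - intros t Ht.
      replace (minus (t ^ (d - 1) * exp (1 * cut (u t))) (t ^ (d - 1) * exp (1 * cut (v t))))
        with (t ^ (d - 1) * (exp (1 * cut (u t)) - exp (1 * cut (v t))))
        by (unfold minus, plus, opp; simpl; ring).
      rewrite Rabs_mult.
      apply Rmult_le_compat; [apply Rabs_pos | apply Rabs_pos | |].
      + rewrite Rabs_pos_eq by (apply pow_le; lra). apply pow_incr; lra.
      + eapply Rle_trans.
        * apply exp_scaled_lipschitz; [rewrite Rabs_R1; lra | apply cut_bound | apply cut_bound].
        * apply Rmult_le_compat_l; [left; apply exp_pos|].
          eapply Rle_trans; [apply clamp_lipschitz | apply He]. }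
  eapply Rle_trans; [exact HF|].
  assert (0 <= (b + 1) ^ (d - 1) * (E * e)).
  { pose proof E_pos. apply Rmult_le_pos; [apply pow_le; lra | apply Rmult_le_pos; lra]. }
  nra.
Qed.

Lemma picard_den_bound (s : R) : s0 <= s -> 0 < / (gamma * s ^ (d - 1)) <= / den.
Proof.
  intros Hs. pose proof den_pos.
  assert (den <= gamma * s ^ (d - 1)).
  { apply Rmult_le_compat_l; [lra|]. apply pow_incr; lra. }
  split; [apply Rinv_0_lt_compat; lra | apply Rinv_le_contravar; lra].
Qed.

Lemma gamma_abs : Rabs (1 - gamma) <= 1.
Proof. apply Rabs_le; lra. Qed.

Lemma picard_rhs_bound (u : R -> R) (s : R) : (forall x, continuous u x) -> s0 <= s <= s0 + 1 ->
  Rabs (picard_rhs s0 m0 u s) <= B1.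
Proof.
  intros Hu Hs. unfold picard_rhs, B1, Rdiv.
  pose proof (picard_den_bound s (proj1 Hs)) as Hden.
  rewrite !Rabs_mult, (Rabs_pos_eq (exp _)), (Rabs_pos_eq (/ _))
    by (first [left; apply exp_pos | lra]).
  apply Rmult_le_compat; [|lra| |lra].
  - apply Rmult_le_pos; [left; apply exp_pos | apply Rabs_pos].
  - apply Rmult_le_compat; [left; apply exp_pos | apply Rabs_pos | |].
    + apply exp_scaled_bound; [apply gamma_abs | apply cut_bound].
    + apply picard_mass_bound; assumption.
Qed.

Lemma picard_rhs_lipschitz (u : R -> R) (v : R -> R) (e : R) (s : R) :
  (forall x, continuous u x) -> (forall x, continuous v x) ->
  (forall x, Rabs (u x - v x) <= e) -> s0 <= s <= s0 + 1 ->
  Rabs (picard_rhs s0 m0 u s - picard_rhs s0 m0 v s) <= B2 * e.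
Proof.
  intros Hu Hv He Hs. unfold picard_rhs, B2.
  assert (0 <= e) by (specialize (He 0); pose proof (Rabs_pos (u 0 - v 0)); lra).
  pose proof (picard_den_bound s (proj1 Hs)) as Hden.
  set (pu := exp ((1 - gamma) * cut (u s))). set (pv := exp ((1 - gamma) * cut (v s))).
  set (mu := picard_mass s0 m0 u s). set (mv := picard_mass s0 m0 v s).
  replace (pu * mu / (gamma * s ^ (d - 1)) - pv * mv / (gamma * s ^ (d - 1)))
    with (((pu - pv) * mu + pv * (mu - mv)) * / (gamma * s ^ (d - 1))) by (unfold Rdiv; ring).
  replace ((E * (M + D) + E * D) / den * e) with ((E * e * (M + D) + E * (D * e)) * / den)
    by (unfold Rdiv; ring).
  rewrite Rabs_mult, (Rabs_pos_eq (/ _)) by lra.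
  apply Rmult_le_compat; [apply Rabs_pos | lra | | lra].
  eapply Rle_trans; [apply Rabs_triang|]. rewrite !Rabs_mult.
  apply Rplus_le_compat; (apply Rmult_le_compat; [apply Rabs_pos | apply Rabs_pos | |]).
  - eapply Rle_trans.
    + apply exp_scaled_lipschitz; [apply gamma_abs | apply cut_bound | apply cut_bound].
    + apply Rmult_le_compat_l; [left; apply exp_pos|].
      eapply Rle_trans; [apply clamp_lipschitz | apply He].
  - apply picard_mass_bound; assumption.
  - rewrite Rabs_pos_eq by (left; apply exp_pos).
    apply exp_scaled_bound; [apply gamma_abs | apply cut_bound].
  - apply picard_mass_lipschitz; assumption.
Qed.

End Initial.

(** The order of the quantifiers is the point: [eps] depends only on the ranges of the initial data,
    so a start close enough to a finite endpoint overshoots it. *)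
Lemma picard_local : exists eps, 0 < eps /\
  forall s0 m0 u0, a <= s0 <= b -> 0 <= m0 <= M -> Rabs u0 <= Lam ->
  exists u : R -> R, u s0 = u0 /\
    forall s, s0 <= s < s0 + eps ->
      is_derive u s (- (exp ((1 - gamma) * u s) *
        (m0 + 4 * PI * RInt (fun y => y ^ (d - 1) * exp (u y)) s0 s) / (gamma * s ^ (d - 1)))).
Proof.
  pose proof B1_nonneg as HB1. pose proof B2_nonneg as HB2.
  (* The three summands give [eps <= 1], so the unit-interval bounds apply; [eps * B1 <= 1], so the
     truncation stays inactive; and [eps * B2 <= 1/2], the contraction ratio. *)
  set (eps := / (1 + B1 + 2 * B2)).
  assert (He : 0 < eps) by (apply Rinv_0_lt_compat; lra).
  assert (Hm : eps * (1 + B1 + 2 * B2) = 1) by (apply Rinv_l; lra).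
  assert (He1 : eps <= 1) by nra.
  assert (HeB1 : eps * B1 <= 1) by nra.
  assert (HeB2 : eps * B2 <= 1 / 2) by nra.
  exists eps. split; [exact He|].
  intros s0 m0 u0 Hs0 Hm0 Hu0.
  (* Clamping the time makes [T] act on functions on the whole line, as [contraction_fixpoint]
     expects. *)
  set (c := clamp s0 (s0 + eps)).
  assert (Hc : forall x, s0 <= c x <= s0 + eps) by (intros x; apply clamp_bounds; lra).
  set (T := fun (u : R -> R) (x : R) => u0 - RInt (picard_rhs s0 m0 u) s0 (c x)).
  assert (Tb : forall u, (forall x, continuous u x) -> forall x, Rabs (T u x - u0) <= 1).
  { intros u Hu x. unfold T.
    replace (u0 - _ - u0) with (- RInt (picard_rhs s0 m0 u) s0 (c x)) by ring.
    rewrite Rabs_Ropp. pose proof (Hc x) as Hcx.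
    apply Rle_trans with ((c x - s0) * B1).
    - apply abs_RInt_le_const; [lra | apply ex_RInt_picard_rhs; auto; lra|].
      intros t Ht. apply picard_rhs_bound; auto; lra.
    - nra. }
  destruct (contraction_fixpoint T (fun _ => u0) 1) as [u [Hu HTu]].
  - intros u Hu x. unfold T.
    apply (continuous_minus (fun _ : R => u0)); [apply continuous_const|].
    apply (continuous_comp c (fun z => RInt (picard_rhs s0 m0 u) s0 z)).
    + apply clamp_continuous.
    + apply (ex_derive_continuous (fun z => RInt (picard_rhs s0 m0 u) s0 z)). eexists.
      pose proof (Hc x). apply picard_rhs_derive; auto; lra.
  - intros u v e Hu Hv Huv x. unfold T.
    replace (u0 - _ - (u0 - _)) with
      (- (RInt (picard_rhs s0 m0 u) s0 (c x) - RInt (picard_rhs s0 m0 v) s0 (c x))) by ring.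
    rewrite Rabs_Ropp. pose proof (Hc x) as Hcx.
    assert (0 <= e) by (specialize (Huv 0); pose proof (Rabs_pos (u 0 - v 0)); lra).
    change (Rabs (minus (RInt (picard_rhs s0 m0 u) s0 (c x)) (RInt (picard_rhs s0 m0 v) s0 (c x)))
      <= e / 2).
    rewrite <- (RInt_minus (V:=R_CompleteNormedModule)) by (apply ex_RInt_picard_rhs; auto; lra).
    apply Rle_trans with ((c x - s0) * (B2 * e)).
    + apply abs_RInt_le_const; [lra | |].
      * apply (ex_RInt_minus (V:=R_CompleteNormedModule)); apply ex_RInt_picard_rhs; auto; lra.
      * intros t Ht. apply picard_rhs_lipschitz; auto; lra.
    + assert ((c x - s0) * B2 <= 1 / 2) by nra. nra.
  - intros x. apply continuous_const.
  - apply Tb. intros x; apply continuous_const.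
  (* The fixed point [u] is constant to the left of [s0]. Its unclamped version [v] agrees with it
     on the time window and has a two-sided derivative at [s0], which the gluing requires. *)
  - set (v := fun x => u0 - RInt (picard_rhs s0 m0 u) s0 x).
    assert (Hvu : forall x, s0 <= x <= s0 + eps -> v x = u x).
    { intros x Hx. rewrite <- HTu. unfold T, v, c. rewrite clamp_id by lra. reflexivity. }
    assert (Hcut : forall x, cut (u x) = u x).
    { intros x. apply clamp_id. pose proof (Tb u Hu x) as H. rewrite HTu in H.
      apply Rabs_le_between in H. apply Rabs_le_between in Hu0. lra. }
    exists v. split.
    + unfold v. rewrite RInt_point. unfold zero; simpl. ring.
    + intros s Hs.
      replace (- _) with (- picard_rhs s0 m0 u s).
      * apply (is_derive_ext (fun x => u0 - RInt (picard_rhs s0 m0 u) s0 x)); [reflexivity|].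
        evar_last.
        -- apply (is_derive_minus (fun _ : R => u0)); [apply is_derive_const|].
           apply picard_rhs_derive; auto; lra.
        -- unfold minus, plus, opp, zero; simpl. ring.
      * unfold picard_rhs, picard_mass. rewrite Hcut, Hvu by lra.
        replace (RInt (fun y => y ^ (d - 1) * exp (1 * cut (u y))) s0 s)
          with (RInt (fun y => y ^ (d - 1) * exp (v y)) s0 s); [reflexivity|].
        apply RInt_ext. rewrite Rmin_left, Rmax_right by lra. intros x Hx.
        rewrite Hcut, Hvu, Rmult_1_l by lra. reflexivity.
Qed.

End Picard.

(** * Continuation *)

Lemma Rpower_derive (f : R -> R) (x g l : R) : 0 < f x -> is_derive f x (f x * l) ->
  is_derive (fun s => Rpower (f s) g) x (g * l * Rpower (f x) g).
Proof.
  intros Hx Hf. unfold Rpower.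
  evar_last.
  - apply (is_derive_comp exp (fun s => g * ln (f s))); [apply is_derive_exp|].
    apply is_derive_scal. apply (is_derive_comp ln f); [apply is_derive_ln, Hx | exact Hf].
  - unfold scal; simpl; unfold mult; simpl. field. lra.
Qed.

(** Used to pass from the known derivative of [ln rho] to [rho] itself; positivity is needed near
    [x], not just at [x], for [exp] to undo [ln] there. *)
Lemma is_derive_of_ln (f : R -> R) (x l : R) :
  locally x (fun y => 0 < f y) -> is_derive (fun s => ln (f s)) x l -> is_derive f x (f x * l).
Proof.
  intros Hp Hl.
  apply (is_derive_ext_loc (fun s => exp (ln (f s)))).
  { apply filter_imp with (2 := Hp). intros y Hy. apply exp_ln, Hy. }
  evar_last.
  - apply (is_derive_comp exp (fun s => ln (f s))); [apply is_derive_exp | exact Hl].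
  - unfold scal; simpl; unfold mult; simpl.
    rewrite exp_ln by (apply (locally_singleton _ _ Hp)). ring.
Qed.

Section Extension.
Context (d : nat) (gamma rho0 b : R) (rho : R -> R).
Context (Hd : (3 <= d)%nat) (Hg : 1 <= gamma) (Hg2 : gamma < 2 * INR d / (INR d + 2)).
Context (Hsol : LE_solution d gamma rho0 (Finite b) rho).

Lemma glue_solution (s0 b' : R) (u : R -> R) :
  0 < s0 < b -> b < b' -> u s0 = ln (rho s0) ->
  (forall s, s0 <= s < b' ->
      is_derive u s (- (exp ((1 - gamma) * u s) *
        (mass d rho s0 + 4 * PI * RInt (fun y => y ^ (d - 1) * exp (u y)) s0 s)
          / (gamma * s ^ (d - 1))))) ->
  LE_solution d gamma rho0 (Finite b') (fun r => if Rle_dec r s0 then rho r else exp (u r)).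
Proof.
  intros Hs0 Hb' Hu0 Hu.
  set (rho' := fun r => if Rle_dec r s0 then rho r else exp (u r)).
  assert (Hrp : forall r, 0 <= r < b -> 0 < rho r).
  { intros r Hr. apply (rho_pos d gamma rho0 b rho Hsol); simpl; lra. }
  assert (Hu0' : exp (u s0) = rho s0) by (rewrite Hu0; apply exp_ln, Hrp; lra).
  assert (Hle : forall r, r <= s0 -> rho' r = rho r).
  { intros r Hr. unfold rho'. destruct Rle_dec; [reflexivity | lra]. }
  assert (Hge : forall r, s0 <= r -> rho' r = exp (u r)).
  { intros r Hr. unfold rho'. destruct Rle_dec; [|reflexivity].
    replace r with s0 by lra. symmetry; exact Hu0'. }
  assert (Hpos : forall r, 0 <= r -> 0 < rho' r).
  { intros r Hr. destruct (Rle_lt_dec r s0).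
    - rewrite Hle by assumption. apply Hrp; lra.
    - rewrite Hge by lra. apply exp_pos. }
  assert (Hmle : forall r, 0 <= r <= s0 -> mass d rho' r = mass d rho r).
  { intros r Hr. unfold mass. f_equal. apply RInt_ext.
    rewrite Rmin_left, Rmax_right by lra. intros x Hx. rewrite Hle by lra. reflexivity. }
  assert (Huc : forall s, s0 <= s < b' -> continuous u s).
  { intros s Hs. apply (ex_derive_continuous u). eexists. apply Hu, Hs. }
  assert (Hmge : forall s, s0 <= s < b' -> mass d rho' s =
    mass d rho s0 + 4 * PI * RInt (fun y => y ^ (d - 1) * exp (u y)) s0 s).
  { intros s Hs. rewrite <- (Hmle s0) by lra. unfold mass.
    rewrite <- Rmult_plus_distr_l. f_equal.
    rewrite (RInt_ext (fun y => y ^ (d - 1) * exp (u y)) (fun y => y ^ (d - 1) * rho' y) s0 s).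
    2:{ rewrite Rmin_left, Rmax_right by lra. intros x Hx. rewrite Hge by lra. reflexivity. }
    symmetry. apply (RInt_Chasles (V:=R_CompleteNormedModule)).
    - apply (ex_RInt_ext (V:=R_NormedModule) (fun y => y ^ (d - 1) * rho (Rmax 0 y))).
      + rewrite Rmin_left, Rmax_right by lra. intros x Hx.
        rewrite Rmax_right, Hle by lra. reflexivity.
      + apply (ex_RInt_mass_density d gamma rho0 b); auto; simpl; lra.
    - apply (ex_RInt_ext (V:=R_NormedModule) (fun y => y ^ (d - 1) * exp (u y))).
      + rewrite Rmin_left, Rmax_right by lra. intros x Hx. rewrite Hge by lra. reflexivity.
      + apply (ex_RInt_continuous (V:=R_CompleteNormedModule)).
        rewrite Rmin_left, Rmax_right by lra. intros x Hx.
        apply (continuous_mult (fun y => y ^ (d - 1))); [apply pow_continuous|].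
        apply (continuous_comp u exp); [apply Huc; lra|].
        apply (ex_derive_continuous exp). eexists; apply is_derive_exp. }
  (* Both one-sided formulas are expressed through [rho'] and its own mass, so that at [s0] they are
     literally the same derivative. *)
  assert (HuD : forall s, s0 <= s < b' -> is_derive (fun y => exp (u y)) s (rho' s *
    (- (exp ((1 - gamma) * ln (rho' s)) * mass d rho' s / (gamma * s ^ (d - 1)))))).
  { intros s Hs. rewrite Hmge, Hge, ln_exp by lra.
    evar_last.
    - apply (is_derive_comp exp u); [apply is_derive_exp | apply Hu, Hs].
    - unfold scal; simpl; unfold mult; simpl. ring. }
  assert (HrD : forall s, 0 < s <= s0 -> is_derive rho s (rho' s *
    (- (exp ((1 - gamma) * ln (rho' s)) * mass d rho' s / (gamma * s ^ (d - 1)))))).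
  { intros s Hs. rewrite Hmle, Hle by lra. apply is_derive_of_ln.
    - assert (Hm : 0 < Rmin s (b - s)) by (apply Rmin_pos; lra).
      exists (mkposreal _ Hm). intros y Hy.
      assert (Hy' : Rabs (y - s) < Rmin s (b - s)) by exact Hy. apply Rabs_def2 in Hy'.
      pose proof (Rmin_l s (b - s)). pose proof (Rmin_r s (b - s)). apply Hrp; lra.
    - apply (lnrho_derive d gamma rho0 b); auto; simpl; lra. }
  assert (HD : forall s, 0 < s < b' -> is_derive rho' s (rho' s *
    (- (exp ((1 - gamma) * ln (rho' s)) * mass d rho' s / (gamma * s ^ (d - 1)))))).
  { intros s Hs. destruct (Rtotal_order s s0) as [Hlt | [-> | Hgt]].
    - apply (is_derive_ext_loc rho); [|apply HrD; lra].
      apply filter_imp with (2 := open_lt s0 s Hlt).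
      intros y Hy. symmetry; apply Hle; lra.
    - apply glue_derive; [apply HrD; lra | apply HuD; lra | symmetry; exact Hu0'].
    - apply (is_derive_ext_loc (fun y => exp (u y))); [|apply HuD; lra].
      apply filter_imp with (2 := open_gt s0 s Hgt).
      intros y Hy. symmetry; apply Hge; lra. }
  split; [|split; [|split; [|split]]].
  - simpl; lra.
  - rewrite Hle by lra. apply Hsol.
  - intros r Hr _. apply Hpos, Hr.
  (* At the origin [rho'] coincides locally with [rho] and inherits its one-sided continuity;
     elsewhere continuity follows from differentiability. *)
  - intros r Hr Hrb. simpl in Hrb. destruct (Req_dec r 0) as [-> | Hr0].
    + rewrite (Hle 0) by lra.
      destruct Hsol as (_ & _ & _ & Hc & _).
      specialize (Hc 0 (Rle_refl 0) ltac:(simpl; lra)).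
      intros P HP. specialize (Hc P HP).
      assert (Hl : locally 0 (fun y => y < s0)) by (apply open_lt; lra).
      unfold filtermap, within in *.
      generalize (filter_and _ _ Hc Hl). apply filter_imp.
      intros y [H1 H2] [Hy0 _]. rewrite Hle by lra. apply H1. split; [exact Hy0 | simpl; lra].
    + apply (filterlim_filter_le_1 (F := locally r)).
      * apply filter_le_within.
      * apply (ex_derive_continuous rho'). eexists. apply HD. lra.
  - intros r Hr Hrb. simpl in Hrb.
    evar_last.
    + apply Rpower_derive; [apply Hpos; lra | apply HD; lra].
    + assert (Hp : 0 < rho' r) by (apply Hpos; lra).
      assert (r ^ (d - 1) <> 0) by (apply pow_nonzero; lra).
      unfold Rpower.
      rewrite <- (exp_ln (rho' r) Hp) at 3.
      replace (ln (rho' r)) with ((1 - gamma) * ln (rho' r) + gamma * ln (rho' r)) at 3 by ring.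
      rewrite exp_plus. field. lra.
Qed.

Lemma solution_extends : exists b' rho', b < b' /\ LE_solution d gamma rho0 (Finite b') rho'.
Proof.
  assert (Hb : 0 < b) by (apply (Rg_pos d gamma rho0 b rho Hsol)).
  pose proof (dim_ge_3 d Hd) as HdR.
  pose proof (gamma_lt_2 d gamma Hd Hg2) as Hg3.
  assert (Hr0 : 0 < rho0).
  { rewrite <- (proj1 (proj2 Hsol)). apply (rho_pos d gamma rho0 b); auto; lra. }
  (* The lower bound of [lnrho_lower] started at [b / 2] and evaluated at the endpoint [b]; it holds
     on all of [[b/2, b)]. *)
  set (lo := ln (rho (b / 2)) - 2 * INR d / gamma * (ln b - ln (b / 2))).
  set (Lam := Rmax (Rabs lo) (Rabs (ln rho0))).
  assert (Hln : forall r, b / 2 <= r < b -> Rabs (ln (rho r)) <= Lam).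
  { intros r Hr.
    assert (ln (rho r) <= ln rho0).
    { rewrite <- (proj1 (proj2 Hsol)). apply (lnrho_decr d gamma rho0 b); auto; simpl; lra. }
    assert (lo <= ln (rho r)).
    { eapply Rle_trans;
        [|apply (lnrho_lower d gamma rho0 b rho Hd Hg Hg2 Hsol (b / 2) r); simpl; lra].
      unfold lo. apply Rplus_le_compat_l, Ropp_le_contravar, Rmult_le_compat_l.
      - apply Rmult_le_pos; [lra | left; apply Rinv_0_lt_compat; lra].
      - assert (ln r <= ln b) by (apply ln_le; lra). lra. }
    unfold Lam, Rmax, Rabs. repeat destruct Rle_dec; repeat destruct Rcase_abs; lra. }
  set (M := 4 * PI * (rho0 * b ^ d / INR d)).
  assert (HM : 0 <= M).
  { pose proof PI_RGT_0. pose proof (pow_lt b d Hb).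
    apply Rmult_le_pos; [lra|]. apply Rmult_le_pos; [nra | left; apply Rinv_0_lt_compat; lra]. }
  assert (Hmass : forall r, 0 < r < b -> 0 <= mass d rho r <= M).
  { intros r Hr. split; [apply (mass_nonneg d gamma rho0 b); auto; simpl; lra|].
    eapply Rle_trans; [apply (mass_upper d gamma rho0 b); auto; simpl; lra|].
    pose proof PI_RGT_0. apply Rmult_le_compat_l; [lra|].
    apply Rmult_le_compat_r; [left; apply Rinv_0_lt_compat; lra|].
    apply Rmult_le_compat_l; [lra|]. apply pow_incr; lra. }
  destruct (picard_local d gamma (b / 2) b Lam M) as [eps [Heps Hloc]]; [lra | lra | | exact HM |].
  { unfold Lam. eapply Rle_trans; [apply (Rabs_pos lo) | apply Rmax_l]. }
  (* Late enough for [s0 + eps] to pass [b], but not before [b / 2], where the bounds [Lam] and [M]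
     are available. *)
  set (s0 := Rmax (b / 2) (b - eps / 2)).
  assert (Hs0 : b / 2 <= s0 < b /\ b < s0 + eps).
  { unfold s0, Rmax. destruct Rle_dec; lra. }
  destruct (Hloc s0 (mass d rho s0) (ln (rho s0))) as [u [Hu0 Hu]];
    [lra | apply Hmass; lra | apply Hln; lra|].
  eexists (s0 + eps), _. split; [lra|].
  apply (glue_solution s0 (s0 + eps) u); auto; lra.
Qed.

End Extension.

Lemma profile_global (d : nat) (gamma rho0 : R) (Rg : Rbar) (rho : R -> R) :
  (3 <= d)%nat -> 1 <= gamma -> gamma < 2 * INR d / (INR d + 2) ->
  LE_profile d gamma rho0 Rg rho -> Rg = p_infty.
Proof.
  intros Hd Hg Hg2 [Hsol Hmax]. destruct Rg as [b| |]; [|reflexivity|].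
  - destruct (solution_extends d gamma rho0 b rho Hd Hg Hg2 Hsol) as (b' & rho' & Hb & Hs).
    specialize (Hmax _ _ Hs). simpl in Hmax. lra.
  - destruct (Rg_pos _ _ _ _ _ Hsol).
Qed.

(** * Damped decay *)

Lemma abs_le_of_sq (x k : R) : 0 <= k -> x ^ 2 <= k ^ 2 -> Rabs x <= k.
Proof. intros Hk H. apply Rabs_le. split; nra. Qed.

(* The cross term [eps * y * (x - xs)] turns the semidefinite dissipation [- kappa * y ^ 2] of the
   energy [y ^ 2 / 2 + G x] into a definite one, comparable with the energy itself. *)
Lemma damped_decay (kappa P c1 c2 C2 xs r0 : R) (p g G dG X Y : R -> R) :
  0 < kappa -> 0 < P -> 0 < c1 -> 0 < c2 -> 0 <= C2 -> 0 < r0 ->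
  (forall r, r0 <= r -> is_derive X r (p (X r) * Y r / r)) ->
  (forall r, r0 <= r -> is_derive Y r ((- kappa * Y r - g (X r)) / r)) ->
  (forall x, is_derive G x (dG x)) ->
  (forall x, dG x * p x = g x) ->
  (forall r, r0 <= r -> p (X r) <= P) ->
  (forall r, r0 <= r -> c1 * (X r - xs) ^ 2 <= g (X r) * (X r - xs)) ->
  (forall r, r0 <= r -> c2 * (X r - xs) ^ 2 <= G (X r) <= C2 * (X r - xs) ^ 2) ->
  exists c K, 0 < c /\ 0 < K /\ forall r, r0 <= r ->
    Rabs (X r - xs) <= K * Rpower r (- c) /\ Rabs (Y r) <= K * Rpower r (- c).
Proof.
  intros Hk HP Hc1 Hc2 HC2 Hr0 HX HY HG HdG Hp Hgc HGc.
  (* The first bound lets half of the friction absorb the [y^2] terms created by the correction. The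
     other two keep the corrected energy above a positive definite quadratic form. *)
  set (eps := Rmin (kappa / (2 * (P + kappa ^ 2 / (2 * c1)))) (Rmin (1 / 2) c2)).
  assert (Hk2 : 0 < kappa ^ 2 / (2 * c1)) by (apply Rdiv_lt_0_compat; nra).
  assert (He : 0 < eps).
  { unfold eps. repeat apply Rmin_pos; try lra. apply Rdiv_lt_0_compat; lra. }
  assert (He1 : eps * (P + kappa ^ 2 / (2 * c1)) <= kappa / 2).
  { apply Rle_trans with (kappa / (2 * (P + kappa ^ 2 / (2 * c1))) * (P + kappa ^ 2 / (2 * c1))).
    - apply Rmult_le_compat_r; [lra | apply Rmin_l].
    - right. field. split; [lra | nra]. }
  assert (He2 : eps <= 1 / 2 /\ eps <= c2).
  { pose proof (Rmin_r (kappa / (2 * (P + kappa ^ 2 / (2 * c1)))) (Rmin (1 / 2) c2)) as H.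
    fold eps in H. pose proof (Rmin_l (1 / 2) c2). pose proof (Rmin_r (1 / 2) c2). lra. }
  set (F := fun r => Y r ^ 2 / 2 + G (X r) + eps * (Y r * (X r - xs))).
  set (dF := fun r => (- kappa * Y r ^ 2
     + eps * (p (X r) * Y r ^ 2 - kappa * (Y r * (X r - xs)) - g (X r) * (X r - xs))) / r).
  assert (HF : forall r, r0 <= r -> is_derive F r (dF r)).
  { intros r Hr. specialize (HX r Hr). specialize (HY r Hr). specialize (HG (X r)).
    unfold F. auto_derive.
    - repeat split; try (eexists; eassumption).
    - rewrite (Derive_eta X r _ HX), (Derive_eta Y r _ HY), (Derive_eta G (X r) _ HG).
      unfold dF. rewrite <- (HdG (X r)). field. lra. }
  set (c3 := Rmin (kappa / 2) (eps * c1 / 2)).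
  assert (Hc3 : 0 < c3) by (apply Rmin_pos; [lra | apply Rdiv_lt_0_compat; nra]).
  assert (Hc3k : c3 <= kappa / 2 /\ c3 <= eps * c1 / 2) by (split; [apply Rmin_l | apply Rmin_r]).
  assert (Hdiss : forall r, r0 <= r -> r * dF r <= - c3 * (Y r ^ 2 + (X r - xs) ^ 2)).
  { intros r Hr. unfold dF.
    replace (r * (_ / r)) with (- kappa * Y r ^ 2
     + eps * (p (X r) * Y r ^ 2 - kappa * (Y r * (X r - xs)) - g (X r) * (X r - xs)))
      by (field; lra).
    specialize (Hp r Hr). specialize (Hgc r Hr).
    set (y := Y r) in *. set (h := X r - xs) in *.
    (* Young's inequality, weighted so that exactly half of the restoring term [c1 * h^2] is
       spent. *)
    assert (H1 : - kappa * (y * h) <= c1 * h ^ 2 / 2 + kappa ^ 2 / (2 * c1) * y ^ 2).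
    { enough (0 <= (c1 * h + kappa * y) ^ 2 / (2 * c1)).
      { replace ((c1 * h + kappa * y) ^ 2 / (2 * c1)) with
          (c1 * h ^ 2 / 2 + kappa ^ 2 / (2 * c1) * y ^ 2 + kappa * (y * h)) in H by (field; lra).
        lra. }
      apply Rmult_le_pos; [apply pow2_ge_0 | left; apply Rinv_0_lt_compat; lra]. }
    assert (Hy : 0 <= y ^ 2) by apply pow2_ge_0. assert (Hh : 0 <= h ^ 2) by apply pow2_ge_0.
    assert (H2 : p (X r) * y ^ 2 <= P * y ^ 2) by (apply Rmult_le_compat_r; assumption).
    assert (H3 : eps * (p (X r) * y ^ 2 - kappa * (y * h) - g (X r) * h) <=
       eps * (P + kappa ^ 2 / (2 * c1)) * y ^ 2 - eps * c1 / 2 * h ^ 2).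
    { replace (eps * (P + kappa ^ 2 / (2 * c1)) * y ^ 2 - eps * c1 / 2 * h ^ 2) with
        (eps * (P * y ^ 2 + (c1 * h ^ 2 / 2 + kappa ^ 2 / (2 * c1) * y ^ 2) - c1 * h ^ 2))
        by (field; lra).
      apply Rmult_le_compat_l; lra. }
    assert (H4 : eps * (P + kappa ^ 2 / (2 * c1)) * y ^ 2 <= kappa / 2 * y ^ 2)
      by (apply Rmult_le_compat_r; assumption).
    assert (H5 : c3 * y ^ 2 <= kappa / 2 * y ^ 2) by (apply Rmult_le_compat_r; lra).
    assert (H6 : c3 * h ^ 2 <= eps * c1 / 2 * h ^ 2) by (apply Rmult_le_compat_r; lra).
    lra. }
  assert (Hlow : forall r, r0 <= r -> Y r ^ 2 / 4 + c2 / 2 * (X r - xs) ^ 2 <= F r).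
  { intros r Hr. unfold F. specialize (HGc r Hr).
    set (y := Y r) in *. set (h := X r - xs) in *.
    assert (- (y ^ 2 + h ^ 2) / 2 <= y * h) by (pose proof (pow2_ge_0 (y + h)); lra).
    assert (0 <= y ^ 2) by apply pow2_ge_0. assert (0 <= h ^ 2) by apply pow2_ge_0.
    assert (eps * (- (y ^ 2 + h ^ 2) / 2) <= eps * (y * h)) by (apply Rmult_le_compat_l; lra).
    nra. }
  assert (Hup : forall r, r0 <= r -> F r <= (1 + C2) * (Y r ^ 2 + (X r - xs) ^ 2)).
  { intros r Hr. unfold F. specialize (HGc r Hr).
    set (y := Y r) in *. set (h := X r - xs) in *.
    assert (y * h <= (y ^ 2 + h ^ 2) / 2) by (pose proof (pow2_ge_0 (y - h)); lra).
    assert (0 <= y ^ 2) by apply pow2_ge_0. assert (0 <= h ^ 2) by apply pow2_ge_0.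
    assert (eps * (y * h) <= eps * ((y ^ 2 + h ^ 2) / 2)) by (apply Rmult_le_compat_l; lra).
    nra. }
  (* From [Hdiss] and [Hup], [r F' <= - 2 c F]. The half appears because [F] controls the squares of
     the quantities to be estimated. *)
  set (c := c3 / (1 + C2) / 2).
  assert (Hc : 0 < c) by (unfold c; apply Rdiv_lt_0_compat; [apply Rdiv_lt_0_compat|]; lra).
  assert (Hdec : forall r, r0 <= r -> Rpower r (2 * c) * F r <= Rpower r0 (2 * c) * F r0).
  { intros r Hr.
    apply (derive_nonpos_decr_closed (fun r => Rpower r (2 * c) * F r)
      (fun r => Rpower r (2 * c) * ((2 * c * F r + r * dF r) / r))); [exact Hr| |].
    - intros x Hx.
      assert (HFx : is_derive F x (dF x)) by (apply HF; lra).
      evar_last.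
      + apply (is_derive_mult (fun r => Rpower r (2 * c)) F x).
        * apply (is_derive_comp exp (fun r => 2 * c * ln r)); [apply is_derive_exp|].
          apply is_derive_scal. apply is_derive_ln. lra.
        * exact HFx.
        * intros; apply Rmult_comm.
      + unfold scal, plus; simpl; unfold mult; simpl. unfold Rpower. field. lra.
    - intros x Hx.
      assert (2 * c * F x + x * dF x <= 0).
      { specialize (Hup x ltac:(lra)). specialize (Hdiss x ltac:(lra)).
        assert (2 * c * F x <= 2 * c * ((1 + C2) * (Y x ^ 2 + (X x - xs) ^ 2)))
          by (apply Rmult_le_compat_l; lra).
        replace (2 * c * ((1 + C2) * (Y x ^ 2 + (X x - xs) ^ 2)))
          with (c3 * (Y x ^ 2 + (X x - xs) ^ 2)) in H by (unfold c; field; lra).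
        lra. }
      assert (0 < Rpower x (2 * c)) by apply exp_pos.
      apply Rmult_le_0_l; [lra|]. apply Rmult_le_0_r; [assumption|].
      left; apply Rinv_0_lt_compat; lra. }
  set (F0 := Rpower r0 (2 * c) * F r0).
  assert (HF0 : 0 <= F0).
  { apply Rmult_le_pos; [left; apply exp_pos|]. eapply Rle_trans; [|apply Hlow; lra].
    pose proof (pow2_ge_0 (Y r0)). pose proof (pow2_ge_0 (X r0 - xs)). nra. }
  assert (HFr : forall r, r0 <= r -> F r <= F0 * Rpower r (- c) ^ 2).
  { intros r Hr. specialize (Hdec r Hr). fold F0 in Hdec.
    replace (Rpower r (- c) ^ 2) with (/ Rpower r (2 * c)).
    2:{ rewrite <- Rpower_Ropp. simpl. rewrite Rmult_1_r, <- Rpower_plus. f_equal. ring. }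
    assert (0 < Rpower r (2 * c)) by apply exp_pos.
    apply Rmult_le_reg_l with (Rpower r (2 * c)); [assumption|].
    replace (Rpower r (2 * c) * (F0 * / Rpower r (2 * c))) with F0 by (field; lra). exact Hdec. }
  (* The squares are bounded by [2 / c2 * F0] and [4 * F0] times the squared rate. Since [K >= 1],
     [K^2 >= K] dominates both without square roots. *)
  set (K := 1 + 4 * F0 + 2 / c2 * F0).
  assert (Hc2' : 0 < 2 / c2) by (apply Rdiv_lt_0_compat; lra).
  assert (HK0 : 0 <= 2 / c2 * F0) by (apply Rmult_le_pos; lra).
  exists c, K. split; [exact Hc|]. split; [unfold K; lra|].
  intros r Hr. specialize (Hlow r Hr). specialize (HFr r Hr).
  assert (HR : 0 < Rpower r (- c)) by apply exp_pos.
  assert (HKR : 0 <= K * Rpower r (- c)) by (apply Rmult_le_pos; unfold K; lra).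
  pose proof (pow2_ge_0 (Y r)). pose proof (pow2_ge_0 (X r - xs)).
  assert (0 <= c2 / 2 * (X r - xs) ^ 2) by (apply Rmult_le_pos; lra).
  set (R2 := Rpower r (- c) ^ 2) in *.
  assert (HR2 : 0 <= R2) by apply pow2_ge_0.
  split; (apply abs_le_of_sq; [exact HKR|]);
    (rewrite Rpow_mult_distr; fold R2).
  - apply Rle_trans with (2 / c2 * F0 * R2).
    + apply Rle_trans with (2 / c2 * (F0 * R2)); [|right; ring].
      apply Rle_trans with (2 / c2 * (c2 / 2 * (X r - xs) ^ 2)); [right; field; lra|].
      apply Rmult_le_compat_l; lra.
    + apply Rmult_le_compat_r; [assumption|]. unfold K. nra.
  - apply Rle_trans with (4 * F0 * R2); [lra|].
    apply Rmult_le_compat_r; [assumption|]. unfold K. nra.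
Qed.

(** * Quadratic comparison and the potential *)

Lemma le_at_critical_point (D dD : R -> R) (xs x : R) :
  (forall t, is_derive D t (dD t)) ->
  (forall t, Rmin xs x <= t <= Rmax xs x -> dD t * (t - xs) <= 0) ->
  D x <= D xs.
Proof.
  intros HD Hs.
  assert (Hsign : forall t, Rmin xs x < t < Rmax xs x -> t <> xs ->
            (xs < t -> dD t <= 0) /\ (t < xs -> 0 <= dD t)).
  { intros t Ht Hne. specialize (Hs t ltac:(lra)). split; intros; nra. }
  assert (Hc : forall t, continuity_pt D t) by (intros t; eapply derive_continuity_pt, HD).
  destruct (Rle_lt_dec xs x) as [H | H].
  - rewrite Rmin_left, Rmax_right in Hsign by lra.
    apply (derive_nonpos_decr D dD); auto. intros t Ht. apply (Hsign t); lra.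
  - rewrite Rmin_right, Rmax_left in Hsign by lra.
    apply Ropp_le_cancel.
    apply (derive_nonpos_decr (fun t => - D t) (fun t => - dD t)); [lra| | |].
    + intros t _. apply (is_derive_opp D), HD.
    + intros t _. apply continuity_pt_opp, Hc.
    + intros t Ht. assert (0 <= dD t) by (apply (Hsign t); lra). lra.
Qed.

(** [G] minus a comparison parabola has a derivative whose sign is fixed on each side of [xs], so
    its extremum is at [xs]. Multiplying by [t - xs] in the hypothesis treats both sides at once. *)
Lemma quadratic_bounds (G dG : R -> R) (xs x c C : R) :
  (forall t, is_derive G t (dG t)) -> G xs = 0 ->
  (forall t, Rmin xs x <= t <= Rmax xs x ->
     c * (t - xs) ^ 2 <= dG t * (t - xs) <= C * (t - xs) ^ 2) ->
  c / 2 * (x - xs) ^ 2 <= G x <= C / 2 * (x - xs) ^ 2.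
Proof.
  intros HG HG0 Hb.
  assert (HQ : forall k t, is_derive (fun t => k / 2 * (t - xs) ^ 2) t (k * (t - xs))).
  { intros k t. auto_derive; trivial. simpl. field. }
  split.
  - assert (c / 2 * (x - xs) ^ 2 - G x <= c / 2 * (xs - xs) ^ 2 - G xs).
    { apply (le_at_critical_point (fun t => c / 2 * (t - xs) ^ 2 - G t)
               (fun t => c * (t - xs) - dG t)).
      - intros t. apply (is_derive_minus (fun t => c / 2 * (t - xs) ^ 2) G); auto.
      - intros t Ht. specialize (Hb t Ht). lra. }
    rewrite HG0 in H. replace (xs - xs) with 0 in H by ring. simpl in H |- *. lra.
  - assert (G x - C / 2 * (x - xs) ^ 2 <= G xs - C / 2 * (xs - xs) ^ 2).
    { apply (le_at_critical_point (fun t => G t - C / 2 * (t - xs) ^ 2)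
               (fun t => dG t - C * (t - xs))).
      - intros t. apply (is_derive_minus G (fun t => C / 2 * (t - xs) ^ 2)); auto.
      - intros t Ht. specialize (Hb t Ht). lra. }
    rewrite HG0 in H. replace (xs - xs) with 0 in H by ring. simpl in H |- *. lra.
Qed.

Lemma expm1_bounds (s S : R) : Rabs s <= S ->
  exp (- S) * s ^ 2 <= (exp s - 1) * s <= exp S * s ^ 2.
Proof.
  intros Hs. rewrite <- exp_0.
  destruct (MVT_gen exp 0 s exp) as [c [Hc ->]].
  - intros x _. apply is_derive_exp.
  - intros x _. eapply derive_continuity_pt, is_derive_exp.
  - assert (- S <= c <= S).
    { revert Hc Hs. unfold Rmin, Rmax, Rabs. repeat destruct Rle_dec; destruct Rcase_abs; lra. }
    assert (exp (- S) <= exp c) by (apply exp_le_compat; lra).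
    assert (exp c <= exp S) by (apply exp_le_compat; lra).
    replace (exp c * (s - 0) * s) with (exp c * s ^ 2) by ring.
    pose proof (pow2_ge_0 s). split; apply Rmult_le_compat_r; assumption.
Qed.

Section Potential.
Context (gamma A xs : R) (Hg : 1 <= gamma < 2) (HA : 0 < A).

Let q := gamma - 1.
Let be := 2 - gamma.

Definition force (x : R) : R := A * exp (q * x) * (exp (be * (x - xs)) - 1).
(** A primitive of [exp (2 * q * x)]; the branch [q = 0] is the isothermal case [gamma = 1]. *)
Definition potential_prim (x : R) : R := if Req_dec_T q 0 then x else exp (2 * q * x) / (2 * q).
Definition potential (x : R) : R :=
  A * exp (- be * xs) * exp (gamma * x) / gamma - A * potential_prim x.
(** Because [x' = exp (- q * x) * y], the energy balance requires the derivative of the potential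
    times [exp (- q * x)] to equal [force]; hence the doubled exponent. *)
Definition potential_deriv (x : R) : R := A * exp (2 * q * x) * (exp (be * (x - xs)) - 1).

Lemma potential_prim_derive (x : R) : is_derive potential_prim x (exp (2 * q * x)).
Proof.
  unfold potential_prim. destruct (Req_dec_T q 0) as [H | H].
  - rewrite H. replace (2 * 0 * x) with 0 by ring. rewrite exp_0. apply (is_derive_id x).
  - auto_derive; trivial. field. exact H.
Qed.

Lemma potential_is_derive (x : R) : is_derive potential x (potential_deriv x).
Proof.
  unfold potential.
  evar_last.
  - apply (is_derive_minus (fun x => A * exp (- be * xs) * exp (gamma * x) / gamma)
      (fun x => A * potential_prim x)).
    + instantiate (1 := A * exp (- be * xs) * exp (gamma * x)). auto_derive; trivial. field. lra.
    + apply is_derive_scal, potential_prim_derive.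
  - unfold minus, plus, opp; simpl. unfold potential_deriv.
    replace (gamma * x) with (2 * q * x + be * x) by (unfold q, be; ring).
    replace (be * (x - xs)) with (be * x + - be * xs) by ring.
    rewrite !exp_plus. ring.
Qed.

Lemma potential_deriv_force (x : R) : potential_deriv x * exp (- q * x) = force x.
Proof.
  unfold potential_deriv, force.
  replace (exp (q * x)) with (exp (2 * q * x) * exp (- q * x))
    by (rewrite <- exp_plus; f_equal; ring).
  ring.
Qed.

(** The free [k] covers [force] with [k = q] and [potential_deriv] with [k = 2 * q]. In [4 * X0],
    one half comes from [exp (k * x)] and the other from the mean value of the exponential. *)
Lemma force_bounds (k x X0 : R) : Rabs k <= 2 -> Rabs x <= X0 -> Rabs xs <= X0 ->
  A * be * exp (- (4 * X0)) * (x - xs) ^ 2 <=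
    A * exp (k * x) * (exp (be * (x - xs)) - 1) * (x - xs)
    <= A * be * exp (4 * X0) * (x - xs) ^ 2.
Proof.
  intros Hk Hx Hxs.
  assert (HX0 : 0 <= X0) by (pose proof (Rabs_pos x); lra).
  assert (Hs : Rabs (be * (x - xs)) <= 2 * X0).
  { rewrite Rabs_mult, (Rabs_pos_eq be) by (unfold be; lra).
    assert (Rabs (x - xs) <= 2 * X0).
    { eapply Rle_trans; [apply Rabs_triang|]. rewrite Rabs_Ropp. lra. }
    assert (be <= 1) by (unfold be; lra). pose proof (Rabs_pos (x - xs)). nra. }
  pose proof (expm1_bounds _ _ Hs) as [H1 H2].
  set (e := exp (be * (x - xs)) - 1) in *.
  assert (Hbe : 0 < be) by (unfold be; lra).
  assert (H1' : be * exp (- (2 * X0)) * (x - xs) ^ 2 <= e * (x - xs)).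
  { apply Rmult_le_reg_l with be; [exact Hbe|]. nra. }
  assert (H2' : e * (x - xs) <= be * exp (2 * X0) * (x - xs) ^ 2).
  { apply Rmult_le_reg_l with be; [exact Hbe|]. nra. }
  assert (Hkx : - (2 * X0) <= k * x <= 2 * X0).
  { apply Rabs_le_between. rewrite Rabs_mult. pose proof (Rabs_pos k). pose proof (Rabs_pos x). nra. }
  assert (H3 : exp (- (2 * X0)) <= exp (k * x)) by (apply exp_le_compat; lra).
  assert (H4 : exp (k * x) <= exp (2 * X0)) by (apply exp_le_compat; lra).
  replace (- (4 * X0)) with (- (2 * X0) + - (2 * X0)) by ring.
  replace (4 * X0) with (2 * X0 + 2 * X0) by ring. rewrite !exp_plus.
  pose proof (exp_pos (- (2 * X0))). pose proof (exp_pos (2 * X0)).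
  pose proof (pow2_ge_0 (x - xs)).
  assert (0 <= be * exp (- (2 * X0)) * (x - xs) ^ 2)
    by (apply Rmult_le_pos; [apply Rmult_le_pos|]; lra).
  split.
  - apply Rle_trans with (A * (exp (- (2 * X0)) * (be * exp (- (2 * X0)) * (x - xs) ^ 2)));
      [right; ring|].
    replace (A * exp (k * x) * e * (x - xs)) with (A * (exp (k * x) * (e * (x - xs)))) by ring.
    apply Rmult_le_compat_l; [lra|]. apply Rmult_le_compat; lra.
  - apply Rle_trans with (A * (exp (2 * X0) * (be * exp (2 * X0) * (x - xs) ^ 2)));
      [|right; ring].
    replace (A * exp (k * x) * e * (x - xs)) with (A * (exp (k * x) * (e * (x - xs)))) by ring.
    apply Rmult_le_compat_l; [lra|]. pose proof (exp_pos (k * x)). apply Rmult_le_compat; lra.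
Qed.

Lemma bounded_damped_decay (kappa X0 r0 : R) (X Y : R -> R) :
  0 < kappa -> 0 < r0 -> Rabs xs <= X0 ->
  (forall r, r0 <= r -> Rabs (X r) <= X0) ->
  (forall r, r0 <= r -> is_derive X r (exp (- q * X r) * Y r / r)) ->
  (forall r, r0 <= r -> is_derive Y r ((- kappa * Y r - force (X r)) / r)) ->
  exists c K, 0 < c /\ 0 < K /\ forall r, r0 <= r ->
    Rabs (X r - xs) <= K * Rpower r (- c) /\ Rabs (Y r) <= K * Rpower r (- c).
Proof.
  intros Hk Hr0 Hxs HXb HX HY.
  assert (Hbe : 0 < be) by (unfold be; lra).
  assert (Hc : forall z, 0 < A * be * exp z).
  { intros z. pose proof (exp_pos z). apply Rmult_lt_0_compat; [apply Rmult_lt_0_compat|]; lra. }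
  assert (Hq : Rabs (2 * q) <= 2) by (apply Rabs_le; unfold q; lra).
  apply (damped_decay kappa (exp X0) (A * be * exp (- (4 * X0)))
    (A * be * exp (- (4 * X0)) / 2) (A * be * exp (4 * X0) / 2) xs r0
    (fun x => exp (- q * x)) force (fun x => potential x - potential xs) potential_deriv);
    auto.
  - apply exp_pos.
  - specialize (Hc (- (4 * X0))). lra.
  - specialize (Hc (4 * X0)). lra.
  - intros x. evar_last.
    + apply (is_derive_minus potential (fun _ => potential xs));
        [apply potential_is_derive | apply is_derive_const].
    + unfold minus, plus, opp, zero; simpl. ring.
  - apply potential_deriv_force.
  - intros r Hr. apply exp_scaled_bound; [apply Rabs_le; unfold q; lra | apply HXb, Hr].
  - intros r Hr. apply force_bounds; auto. apply Rabs_le; unfold q; lra.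
  - intros r Hr.
    apply (quadratic_bounds (fun x => potential x - potential xs) potential_deriv).
    + intros x. evar_last.
      * apply (is_derive_minus potential (fun _ => potential xs));
          [apply potential_is_derive | apply is_derive_const].
      * unfold minus, plus, opp, zero; simpl. ring.
    + ring.
    + intros t Ht. apply force_bounds; auto.
      specialize (HXb r Hr). revert Ht HXb Hxs. unfold Rmin, Rmax, Rabs.
      repeat destruct Rle_dec; repeat destruct Rcase_abs; lra.
Qed.

End Potential.

(** * Asymptotics of the profile *)

Section Asymptotics.
Context (d : nat) (gamma rho0 : R) (rho : R -> R).
Context (Hd : (3 <= d)%nat) (Hg : 1 <= gamma) (Hg2 : gamma < 2 * INR d / (INR d + 2)).
Context (Hr0 : 0 < rho0) (Hsol : LE_solution d gamma rho0 p_infty rho).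

Let q := gamma - 1.
Let be := 2 - gamma.
Let al := 2 / (2 - gamma).
Let kappa := INR d - al * gamma.
(** The value of [4 * PI / gamma * exp (be * X)] at the equilibrium [W = al] of [W_derive],
    simplified with [al * gamma = 2 * al - 2]; [A_exp_xs] says that [xs] attains it. *)
Let A := al * (INR d - al).
Let W := slope d gamma rho.
Let u (r : R) := ln (rho r).
Let X (r : R) := al * ln r + u r.
Let Y (r : R) := exp (q * X r) * (al - W r).
Let xs := ln (LE_A d gamma) / be.

Lemma al_be : al * be = 2.
Proof. unfold al, be. pose proof (gamma_lt_2 d gamma Hd Hg2). field. lra. Qed.

Lemma al_pos : 0 < al.
Proof. pose proof (gamma_lt_2 d gamma Hd Hg2). unfold al. apply Rdiv_lt_0_compat; lra. Qed.

Lemma kappa_pos : 0 < kappa.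
Proof.
  pose proof (gamma_lt_2 d gamma Hd Hg2). pose proof (gamma_subcritical d gamma Hd Hg2).
  replace kappa with ((2 * INR d - gamma * (INR d + 2)) / (2 - gamma))
    by (unfold kappa, al; field; lra).
  apply Rdiv_lt_0_compat; lra.
Qed.

Lemma A_pos : 0 < A.
Proof.
  pose proof kappa_pos. pose proof al_pos. unfold kappa in *. unfold A.
  apply Rmult_lt_0_compat; [assumption|]. nra.
Qed.

Lemma LE_A_eq : LE_A d gamma = gamma * A / (4 * PI).
Proof.
  unfold LE_A, A, al. pose proof (gamma_lt_2 d gamma Hd Hg2). pose proof PI_RGT_0. field. lra.
Qed.

Lemma LE_A_pos : 0 < LE_A d gamma.
Proof.
  rewrite LE_A_eq. pose proof A_pos. pose proof PI_RGT_0.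
  apply Rdiv_lt_0_compat; [apply Rmult_lt_0_compat|]; lra.
Qed.

Lemma A_exp_xs : A * exp (- be * xs) = 4 * PI / gamma.
Proof.
  unfold xs. pose proof (gamma_lt_2 d gamma Hd Hg2). pose proof PI_RGT_0. pose proof A_pos.
  replace (- be * (ln (LE_A d gamma) / be)) with (- ln (LE_A d gamma)) by (unfold be; field; lra).
  rewrite exp_Ropp, exp_ln by apply LE_A_pos. rewrite LE_A_eq. field. lra.
Qed.

Lemma exp_be_X (r : R) : 0 < r -> exp (be * X r) = r ^ 2 * exp (be * u r).
Proof.
  intros Hr. unfold X. replace (be * (al * ln r + u r)) with (ln r + ln r + be * u r).
  - rewrite !exp_plus, exp_ln by exact Hr. ring.
  - replace (be * (al * ln r + u r)) with ((al * be) * ln r + be * u r) by ring.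
    rewrite al_be. ring.
Qed.

Lemma u_derive (r : R) : 0 < r -> is_derive u r (- W r / r).
Proof. intros Hr. apply (lnrho_derive_slope d gamma rho0 p_infty); simpl; auto. Qed.

Lemma X_derive (r : R) : 0 < r -> is_derive X r (exp (- q * X r) * Y r / r).
Proof.
  intros Hr. unfold Y.
  replace (exp (- q * X r) * (exp (q * X r) * (al - W r)) / r) with ((al - W r) / r).
  2:{ rewrite <- Rmult_assoc, <- exp_plus. replace (- q * X r + q * X r) with 0 by ring.
      rewrite exp_0, Rmult_1_l. reflexivity. }
  pose proof (u_derive r Hr) as Hu. unfold X. clearbody u. auto_derive.
  - repeat split; [lra | eexists; exact Hu].
  - rewrite (Derive_eta u r _ Hu). field. lra.
Qed.

(** A Riccati equation in the time [ln r]: the source comes from the growth of the mass, the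
    quadratic term from [rho^(1-gamma)], the linear one from [r^(d-2)]. *)
Lemma W_derive (r : R) : 0 < r -> is_derive W r
  ((4 * PI / gamma * exp (be * X r) + q * W r ^ 2 - (INR d - 2) * W r) / r).
Proof.
  intros Hr. rewrite exp_be_X by exact Hr.
  pose proof (u_derive r Hr) as Hu.
  pose proof (mass_derive d gamma rho0 p_infty rho Hsol r Hr I) as Hm.
  assert (Hrho : rho r = exp (u r)).
  { unfold u. rewrite exp_ln; [reflexivity|].
    apply (rho_pos d gamma rho0 p_infty); simpl; auto; lra. }
  rewrite Hrho in Hm.
  assert (HW : W r = mass d rho r * exp ((1 - gamma) * u r) / (gamma * r ^ (d - 2))) by reflexivity.
  apply (is_derive_ext (fun r => mass d rho r * exp ((1 - gamma) * u r) / (gamma * r ^ (d - 2))));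
    [reflexivity|].
  rewrite HW in *. set (m := mass d rho) in *. clearbody m u.
  destruct d as [|[|[|k]]]; try lia.
  replace (S (S (S k)) - 2)%nat with (S k) in * by lia.
  replace (S (S (S k)) - 1)%nat with (S (S k)) in * by lia.
  assert (Hk : r ^ k <> 0) by (apply pow_nonzero; lra).
  auto_derive.
  - repeat split; try (eexists; eassumption).
    apply Rmult_integral_contrapositive_currified; [lra|].
    apply (pow_nonzero r (S k)); lra.
  - rewrite (Derive_eta m r _ Hm), (Derive_eta u r _ Hu).
    replace (be * u r) with (u r + (1 - gamma) * u r) by (unfold be; ring).
    rewrite exp_plus. unfold q. rewrite !S_INR. simpl pred. simpl (r ^ S _).
    replace (match k with 0%nat => 1 | S _ => INR k + 1 end) with (INR k + 1)
      by (destruct k; simpl; ring).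
    field. repeat split; lra.
Qed.

Lemma Y_derive (r : R) : 0 < r ->
  is_derive Y r ((- kappa * Y r - force gamma A xs (X r)) / r).
Proof.
  intros Hr. pose proof (X_derive r Hr) as HX. pose proof (W_derive r Hr) as HW.
  pose proof A_exp_xs as HA. pose proof al_be as Hab.
  unfold force. fold q be.
  replace (A * exp (q * X r) * (exp (be * (X r - xs)) - 1))
    with (exp (q * X r) * (A * exp (- be * xs) * exp (be * X r) - A)).
  2:{ replace (be * (X r - xs)) with (- be * xs + be * X r) by ring. rewrite exp_plus. ring. }
  rewrite HA.
  replace (exp (- q * X r) * Y r / r) with ((al - W r) / r) in HX.
  2:{ unfold Y. rewrite <- (Rmult_assoc (exp (- q * X r))), <- exp_plus.
      replace (- q * X r + q * X r) with 0 by ring.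
      rewrite exp_0, Rmult_1_l. reflexivity. }
  unfold Y. clearbody X W. auto_derive.
  - repeat split; eexists; eassumption.
  - rewrite (Derive_eta X r _ HX), (Derive_eta W r _ HW).
    assert (Hal : al * gamma = 2 * al - 2) by (unfold be in Hab; lra).
    unfold kappa, A, q. pose proof (gamma_lt_2 d gamma Hd Hg2).
    clear HA HX HW.
    (* With the weight factored out, the [W^2] terms cancel and the rest matches through
       [al * gamma = 2 * al - 2]. *)
    enough (E : (gamma - 1) * (al - W r) * (al - W r)
        - (4 * PI / gamma * exp (be * X r) + (gamma - 1) * W r ^ 2 - (INR d - 2) * W r)
      = - (INR d - al * gamma) * (al - W r)
        - (4 * PI / gamma * exp (be * X r) - al * (INR d - al))).
    { set (e := exp ((gamma - 1) * X r)).
      replace (- (INR d - al * gamma) * (e * (al - W r)) -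
        e * (4 * PI / gamma * exp (be * X r) - al * (INR d - al))) with
        (e * (- (INR d - al * gamma) * (al - W r) -
        (4 * PI / gamma * exp (be * X r) - al * (INR d - al)))) by ring.
      rewrite <- E. field. lra. }
    set (t := 4 * PI / gamma * exp (be * X r)).
    assert (E1 : al * gamma * W r = 2 * al * W r - 2 * W r) by (rewrite Hal; ring).
    assert (E2 : al * gamma * al = 2 * al * al - 2 * al) by (rewrite Hal; ring).
    nra.
Qed.

Lemma W_pos (r : R) : 0 < r -> 0 < W r.
Proof. intros Hr. apply (slope_pos d gamma rho0 p_infty); simpl; auto. Qed.

Lemma W_le (r : R) : 0 < r -> W r <= 2 * INR d.
Proof.
  intros Hr. eapply Rle_trans; [apply (slope_le d gamma rho0 p_infty); simpl; auto|].
  pose proof (dim_ge_3 d Hd). apply Rmult_le_reg_r with gamma; [lra|].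
  unfold Rdiv. rewrite Rmult_assoc, Rinv_l; nra.
Qed.

(** This is [mass_lower] in scaled variables. With [W_le] it bounds [X] from above at every radius,
    including those near the origin. *)
Lemma exp_be_X_le (r : R) : 0 < r -> 4 * PI / gamma * exp (be * X r) <= INR d * W r.
Proof.
  intros Hr. rewrite exp_be_X by exact Hr.
  pose proof (mass_lower d gamma rho0 p_infty rho Hd Hg Hsol r ltac:(lra) I) as Hm.
  assert (Hrho : rho r = exp (u r)).
  { unfold u. rewrite exp_ln; [reflexivity|].
    apply (rho_pos d gamma rho0 p_infty); simpl; auto; lra. }
  rewrite Hrho in Hm. unfold W, slope. fold (u r).
  replace (be * u r) with (u r + (1 - gamma) * u r) by (unfold be; ring).
  rewrite exp_plus. pose proof (dim_ge_3 d Hd). pose proof (pow_lt r (d - 2) Hr) as Hp.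
  pose proof (exp_pos ((1 - gamma) * u r)) as He.
  replace (r ^ d) with (r ^ (d - 2) * r ^ 2) in Hm by (rewrite <- pow_add; f_equal; lia).
  set (m := mass d rho r) in *. set (p := r ^ (d - 2)) in *.
  set (e := exp ((1 - gamma) * u r)) in *.
  replace (4 * PI / gamma * (r ^ 2 * (exp (u r) * e))) with
    (4 * PI * (exp (u r) * (p * r ^ 2) / INR d) * (INR d * e / (gamma * p))) by (field; lra).
  replace (INR d * (m * e / (gamma * p))) with (m * (INR d * e / (gamma * p))) by (field; lra).
  apply Rmult_le_compat_r; [|exact Hm].
  left. apply Rdiv_lt_0_compat; apply Rmult_lt_0_compat; lra.
Qed.

Lemma X_upper : exists x2, forall r, 0 < r -> X r <= x2.
Proof.
  pose proof (gamma_lt_2 d gamma Hd Hg2). pose proof (dim_ge_3 d Hd). pose proof PI_RGT_0.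
  assert (HB : 0 < 4 * PI / gamma) by (apply Rdiv_lt_0_compat; lra).
  set (z := INR d * (2 * INR d) / (4 * PI / gamma)).
  assert (Hz : 0 < z) by (apply Rdiv_lt_0_compat; [nra | lra]).
  exists (ln z / be). intros r Hr.
  assert (Hbe : 0 < be) by (unfold be; lra).
  apply Rmult_le_reg_l with be; [exact Hbe|].
  replace (be * (ln z / be)) with (ln z) by (field; lra).
  rewrite <- (ln_exp (be * X r)). apply ln_le; [apply exp_pos|].
  apply Rmult_le_reg_l with (4 * PI / gamma); [exact HB|].
  eapply Rle_trans; [apply exp_be_X_le, Hr|].
  replace (4 * PI / gamma * z) with (INR d * (2 * INR d)) by (unfold z; field; lra).
  apply Rmult_le_compat_l; [lra | apply W_le, Hr].
Qed.

(** Near the origin the mass is at most a multiple of [r^d], while [rho^(1-gamma)] stays below its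
    value at [r = 1] because [rho] decreases. A linear bound on [W] is all that is retained. *)
Lemma W_small (eta : R) : 0 < eta -> exists r, 0 < r /\ W r <= eta.
Proof.
  intros Heta. pose proof (dim_ge_3 d Hd). pose proof PI_RGT_0.
  set (C := 4 * PI * (rho0 / INR d) * exp ((1 - gamma) * u 1) / gamma).
  assert (HC : 0 < C).
  { apply Rdiv_lt_0_compat; [|lra]. apply Rmult_lt_0_compat; [|apply exp_pos].
    apply Rmult_lt_0_compat; [lra|]. apply Rdiv_lt_0_compat; lra. }
  assert (HW : forall r, 0 < r <= 1 -> W r <= C * r).
  { intros r Hr. unfold W, slope. fold (u r).
    pose proof (mass_upper d gamma rho0 p_infty rho Hd Hg Hsol r ltac:(lra) I) as Hm.
    pose proof (mass_nonneg d gamma rho0 p_infty rho Hsol r ltac:(lra) I) as Hm0.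
    assert (Hu : exp ((1 - gamma) * u r) <= exp ((1 - gamma) * u 1)).
    { apply exp_le_compat.
      assert (u 1 <= u r) by (apply (lnrho_decr d gamma rho0 p_infty); simpl; auto; lra). nra. }
    pose proof (exp_pos ((1 - gamma) * u r)).
    pose proof (pow_lt r (d - 2) (proj1 Hr)) as Hp.
    replace (r ^ d) with (r ^ (d - 2) * r ^ 2) in Hm by (rewrite <- pow_add; f_equal; lia).
    set (p := r ^ (d - 2)) in *.
    apply Rle_trans with (4 * PI * (rho0 * (p * r ^ 2) / INR d) * exp ((1 - gamma) * u 1)
      / (gamma * p)).
    - apply Rmult_le_compat_r; [left; apply Rinv_0_lt_compat, Rmult_lt_0_compat; lra|].
      apply Rmult_le_compat; lra.
    - replace (4 * PI * (rho0 * (p * r ^ 2) / INR d) * exp ((1 - gamma) * u 1) / (gamma * p))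
        with (C * r ^ 2) by (unfold C; field; lra).
      apply Rmult_le_compat_l; nra. }
  assert (0 < eta / C) by (apply Rdiv_lt_0_compat; lra).
  exists (Rmin 1 (eta / C)).
  assert (Hp : 0 < Rmin 1 (eta / C)) by (apply Rmin_pos; lra).
  split; [exact Hp|].
  eapply Rle_trans; [apply HW; split; [exact Hp | apply Rmin_l]|].
  apply Rle_trans with (C * (eta / C)); [apply Rmult_le_compat_l; [lra | apply Rmin_r]|].
  right; field; lra.
Qed.

(** * Energy and the lower bound on [X] *)

Let En (r : R) := Y r ^ 2 / 2 + potential gamma A xs (X r).

Lemma energy_decr (r s : R) : 0 < r <= s -> En s <= En r.
Proof.
  intros Hrs.
  apply (derive_nonpos_decr_closed En (fun r => - kappa * Y r ^ 2 / r)); [lra| |].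
  - intros x Hx. assert (Hx0 : 0 < x) by lra.
    pose proof (X_derive x Hx0) as HX. pose proof (Y_derive x Hx0) as HY.
    pose proof (gamma_lt_2 d gamma Hd Hg2) as Hlt2.
    pose proof (potential_is_derive gamma A xs (conj Hg Hlt2) (X x)) as HP.
    pose proof (potential_deriv_force gamma A xs (X x)) as HF.
    unfold En.
    set (P := potential gamma A xs) in *. clearbody P X Y.
    auto_derive.
    + repeat split; eexists; eassumption.
    + rewrite (Derive_eta X x _ HX), (Derive_eta Y x _ HY), (Derive_eta P (X x) _ HP).
      rewrite <- HF. fold q. field. lra.
  - intros x Hx. pose proof kappa_pos. pose proof (pow2_ge_0 (Y x)).
    unfold Rdiv. apply Rmult_le_0_r; [nra | left; apply Rinv_0_lt_compat; lra].
Qed.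

Lemma potential_lower (x : R) : - (A * potential_prim gamma x) <= potential gamma A xs x.
Proof.
  unfold potential. pose proof A_pos.
  enough (0 <= A * exp (- (2 - gamma) * xs) * exp (gamma * x) / gamma) by lra.
  pose proof (exp_pos (- (2 - gamma) * xs)). pose proof (exp_pos (gamma * x)).
  apply Rmult_le_pos; [|left; apply Rinv_0_lt_compat; lra].
  apply Rmult_le_pos; [apply Rmult_le_pos|]; lra.
Qed.

Lemma energy_lower (r : R) : - (A * potential_prim gamma (X r)) <= En r.
Proof.
  unfold En. pose proof (potential_lower (X r)). pose proof (pow2_ge_0 (Y r)). lra.
Qed.

(* The potential tends to [0] at [-oo] when [gamma > 1], so there the solution is trapped only
   because its energy is negative as soon as [W] is small. *)
Lemma energy_negative : 0 < q -> exists r, 0 < r /\ En r < 0.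
Proof.
  intros Hq. pose proof (dim_ge_3 d Hd). pose proof al_pos. pose proof kappa_pos. pose proof (gamma_lt_2 d gamma Hd Hg2).
  (* As [W] tends to [0], [exp (- 2 q X) * En] tends to [al^2 / 2 - A / (2 q) = - D]. The threshold
     [D / (4 d)] keeps the error [2 d W] below [D / 2]. *)
  set (D := al * kappa / (2 * q)).
  assert (HD : 0 < D) by (apply Rdiv_lt_0_compat; [apply Rmult_lt_0_compat|]; lra).
  destruct (W_small (D / (4 * INR d))) as [r [Hr HW]]; [apply Rdiv_lt_0_compat; lra|].
  exists r. split; [exact Hr|].
  pose proof (W_pos r Hr) as HW0. pose proof (W_le r Hr) as HW1.
  pose proof (exp_be_X_le r Hr) as HX.
  assert (HWD : 2 * INR d * W r <= D / 2).
  { apply Rle_trans with (2 * INR d * (D / (4 * INR d))); [apply Rmult_le_compat_l; lra|].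
    right; field; lra. }
  unfold En, potential, potential_prim. fold q be.
  destruct (Req_dec_T q 0) as [Hq0 | _]; [lra|].
  rewrite A_exp_xs.
  replace (exp (gamma * X r)) with (exp (2 * q * X r) * exp (be * X r))
    by (rewrite <- exp_plus; f_equal; unfold q, be; ring).
  replace (Y r ^ 2) with (exp (2 * q * X r) * (al - W r) ^ 2).
  2:{ unfold Y. replace (2 * q * X r) with (q * X r + q * X r) by ring. rewrite exp_plus. ring. }
  set (e := exp (2 * q * X r)). assert (He : 0 < e) by apply exp_pos.
  set (v := 4 * PI / gamma * exp (be * X r)) in *.
  replace (e * (al - W r) ^ 2 / 2 + (4 * PI / gamma * (e * exp (be * X r)) / gamma - A * (e / (2 * q))))
    with (e * ((al - W r) ^ 2 / 2 + v / gamma - A / (2 * q))) by (unfold v; field; lra).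
  enough ((al - W r) ^ 2 / 2 + v / gamma - A / (2 * q) < 0) by nra.
  assert (Hv0 : 0 < v).
  { unfold v. pose proof PI_RGT_0. apply Rmult_lt_0_compat; [|apply exp_pos].
    apply Rdiv_lt_0_compat; lra. }
  assert (Hv : v / gamma <= INR d * W r).
  { apply Rmult_le_reg_r with gamma; [lra|]. unfold Rdiv. rewrite Rmult_assoc, Rinv_l by lra.
    nra. }
  assert (HAD : A / (2 * q) = al ^ 2 / 2 + D).
  { unfold A, D, kappa. replace gamma with (q + 1) by (unfold q; ring). field. lra. }
  rewrite HAD. nra.
Qed.

Lemma X_lower : exists r0 x1, 0 < r0 /\ forall r, r0 <= r -> x1 <= X r.
Proof.
  pose proof A_pos as HA.
  destruct (Req_dec q 0) as [Hq | Hq].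
  (* For [gamma = 1] the potential contains [- A * x], which grows without bound at [-oo], so the
     energy at any radius is a barrier. *)
  - exists 1, (- En 1 / A). split; [lra|]. intros r Hr.
    pose proof (energy_decr 1 r ltac:(lra)) as H1. pose proof (energy_lower r) as H2.
    unfold potential_prim in H2. fold q in H2.
    destruct (Req_dec_T q 0) as [_ | H]; [|contradiction].
    apply Rmult_le_reg_l with A; [exact HA|].
    replace (A * (- En 1 / A)) with (- En 1) by (field; lra). lra.
  - assert (Hq0 : 0 < q) by (unfold q in *; lra).
    destruct (energy_negative Hq0) as [r0 [Hr0' HE]].
    (* The value of [exp (2 * q * X)] at which [energy_lower] equals [En r0]; it is positive because
       that energy is negative. *)
    set (z := 2 * q * (- En r0) / A).
    assert (Hz : 0 < z) by (apply Rdiv_lt_0_compat; [apply Rmult_lt_0_compat|]; lra).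
    exists r0, (ln z / (2 * q)). split; [exact Hr0'|]. intros r Hr.
    pose proof (energy_decr r0 r ltac:(lra)) as H1. pose proof (energy_lower r) as H2.
    unfold potential_prim in H2. fold q in H2.
    destruct (Req_dec_T q 0) as [H | _]; [contradiction|].
    apply Rmult_le_reg_l with (2 * q); [lra|].
    replace (2 * q * (ln z / (2 * q))) with (ln z) by (field; lra).
    rewrite <- (ln_exp (2 * q * X r)). apply ln_le; [exact Hz|].
    apply Rmult_le_reg_l with (A / (2 * q)); [apply Rdiv_lt_0_compat; lra|].
    replace (A / (2 * q) * z) with (- En r0) by (unfold z; field; lra).
    replace (A / (2 * q) * exp (2 * q * X r)) with (A * (exp (2 * q * X r) / (2 * q)))
      by (field; lra). lra.
Qed.

(** * Return to [rho] and the mass *)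

Lemma profile_v1 (r : R) : 0 < r -> Rpower r (2 / (2 - gamma)) * rho r = exp (X r).
Proof.
  intros Hr. unfold X, u. rewrite exp_plus, exp_ln; [reflexivity|].
  apply (rho_pos d gamma rho0 p_infty); simpl; auto; lra.
Qed.

Lemma v1star_exp : v1star d gamma = exp xs.
Proof. unfold v1star, xs, Rpower, be. f_equal. pose proof (gamma_lt_2 d gamma Hd Hg2). field. lra. Qed.

(** Solving the definition of [slope] for the mass gives [m = gamma W r^(d-2) rho^(gamma-1)], and
    the powers of [r] match because [al * q = al - 2]. *)
Lemma profile_v2 (r : R) : 0 < r ->
  Rpower r (2 / (2 - gamma) - INR d) * mass d rho r = gamma * (W r * exp (q * X r)).
Proof.
  intros Hr. fold al. unfold W, slope. fold (u r).
  rewrite <- (Rpower_pow (d - 2) r Hr). rewrite minus_INR by lia. simpl (INR 2).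
  replace (gamma * (mass d rho r * exp ((1 - gamma) * u r)
     / (gamma * Rpower r (INR d - (1 + 1))) * exp (q * X r)))
    with (mass d rho r * (exp ((1 - gamma) * u r) * / Rpower r (INR d - (1 + 1)) * exp (q * X r))).
  2:{ field. split; [apply Rgt_not_eq, exp_pos | lra]. }
  rewrite (Rmult_comm (Rpower _ _)). f_equal.
  rewrite <- Rpower_Ropp. unfold Rpower. rewrite <- !exp_plus. f_equal.
  pose proof al_be as Hab. unfold X, q.
  replace ((gamma - 1) * (al * ln r + u r)) with ((al - al * be) * ln r + (gamma - 1) * u r)
    by (unfold be; ring).
  rewrite Hab. ring.
Qed.

Lemma v2star_exp : v2star d gamma = gamma * (al * exp (q * xs)).
Proof.
  unfold v2star, xs, Rpower, al, q, be. pose proof (gamma_lt_2 d gamma Hd Hg2).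
  replace ((gamma - 1) / (2 - gamma) * ln (LE_A d gamma))
    with ((gamma - 1) * (ln (LE_A d gamma) / (2 - gamma))) by (field; lra).
  field. lra.
Qed.

Lemma profile_rate : exists c K : R, 0 < c /\ 0 < K /\
  forall r : R, 0 < r ->
    Rabs (Rpower r (2 / (2 - gamma)) * rho r - v1star d gamma) <= K * Rpower r (- c) /\
    Rabs (Rpower r (2 / (2 - gamma) - INR d) * mass d rho r - v2star d gamma)
      <= K * Rpower r (- c).
Proof.
  pose proof (gamma_lt_2 d gamma Hd Hg2) as Hlt2. pose proof al_pos as Hal. pose proof (dim_ge_3 d Hd) as Hd3.
  destruct X_upper as [x2 Hx2]. destruct X_lower as (r0 & x1 & Hr0' & Hx1).
  set (X0 := Rabs xs + Rabs x1 + Rabs x2).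
  pose proof (Rabs_pos xs). pose proof (Rabs_pos x1). pose proof (Rabs_pos x2).
  assert (Hxs : Rabs xs <= X0) by (unfold X0; lra).
  assert (HXb : forall r, r0 <= r -> Rabs (X r) <= X0).
  { intros r Hr. specialize (Hx2 r ltac:(lra)). specialize (Hx1 r Hr).
    pose proof (Rle_abs x2). pose proof (Rabs_maj2 x1).
    apply Rabs_le. unfold X0. lra. }
  destruct (bounded_damped_decay gamma A xs (conj Hg Hlt2) A_pos kappa X0 r0 X Y)
    as (c & K & Hc & HK & Hdec); auto.
  - apply kappa_pos.
  - intros r Hr. apply X_derive; lra.
  - intros r Hr. apply Y_derive; lra.
  - set (E0 := exp X0). assert (HE0 : 0 < E0) by apply exp_pos.
    set (K1 := E0 * K + gamma * (al * (E0 * K) + K)).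
    assert (HEK : 0 < E0 * K) by (apply Rmult_lt_0_compat; lra).
    assert (HaEK : 0 < al * (E0 * K)) by (apply Rmult_lt_0_compat; lra).
    (* Bounds for the two errors valid at every radius, from [X_upper] and [W_le]. For [r < r0] they
       suffice, since there [Rpower r0 c * Rpower r (- c) >= 1]. *)
    set (m1 := E0 + v1star d gamma). set (m2 := gamma * (2 * INR d * E0) + v2star d gamma).
    assert (Hv1 : 0 < v1star d gamma) by (rewrite v1star_exp; apply exp_pos).
    assert (Hv2 : 0 < v2star d gamma).
    { rewrite v2star_exp. pose proof (exp_pos (q * xs)).
      apply Rmult_lt_0_compat; [lra|]. apply Rmult_lt_0_compat; lra. }
    assert (HdE : 0 < 2 * INR d * E0) by (apply Rmult_lt_0_compat; lra).
    assert (Hm : 0 < m1 /\ 0 < m2) by (unfold m1, m2; nra).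
    assert (HR0 : 0 < Rpower r0 c) by apply exp_pos.
    exists c, (K1 + (m1 + m2) * Rpower r0 c).
    assert (HK1 : 0 < K1) by (unfold K1; nra).
    assert (Hmr : 0 < (m1 + m2) * Rpower r0 c) by (apply Rmult_lt_0_compat; lra).
    split; [exact Hc|]. split; [lra|].
    intros r Hr. assert (HR : 0 < Rpower r (- c)) by apply exp_pos.
    rewrite profile_v1, profile_v2 by exact Hr.
    destruct (Rle_lt_dec r0 r) as [Hge | Hlt].
    + destruct (Hdec r Hge) as [H3 H4]. specialize (HXb r Hge).
      set (R := Rpower r (- c)) in *.
      assert (Hexp : forall k, Rabs k <= 1 -> Rabs (exp (k * X r) - exp (k * xs)) <= E0 * K * R).
      { intros k Hk. eapply Rle_trans; [apply (exp_scaled_lipschitz k _ _ X0); assumption|].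
        rewrite Rmult_assoc. apply Rmult_le_compat_l; lra. }
      assert (HmR : 0 < (m1 + m2) * Rpower r0 c * R) by (apply Rmult_lt_0_compat; lra).
      assert (HKR : 0 < K * R) by (apply Rmult_lt_0_compat; lra).
      assert (HEKR : 0 < E0 * K * R) by (apply Rmult_lt_0_compat; lra).
      assert (HaR : 0 < al * (E0 * K * R)) by (apply Rmult_lt_0_compat; lra).
      split.
      * rewrite v1star_exp. specialize (Hexp 1). rewrite !Rmult_1_l in Hexp.
        eapply Rle_trans; [apply Hexp; rewrite Rabs_R1; lra|].
        unfold K1. nra.
      * rewrite v2star_exp.
        (* Writing [W] through [Y] splits the error into an exponential difference, controlled by
           [X - xs], and [Y] itself. *)
        replace (gamma * (W r * exp (q * X r)) - gamma * (al * exp (q * xs)))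
          with (gamma * (al * (exp (q * X r) - exp (q * xs)) - Y r)) by (unfold Y; ring).
        rewrite Rabs_mult, (Rabs_pos_eq gamma) by lra.
        assert (Rabs (al * (exp (q * X r) - exp (q * xs)) - Y r) <= al * (E0 * K * R) + K * R).
        { eapply Rle_trans; [apply Rabs_triang|]. rewrite Rabs_Ropp, Rabs_mult, (Rabs_pos_eq al) by lra.
          apply Rplus_le_compat; [|exact H4]. apply Rmult_le_compat_l; [lra|].
          apply Hexp. apply Rabs_le; unfold q; lra. }
        apply Rle_trans with (gamma * (al * (E0 * K * R) + K * R));
          [apply Rmult_le_compat_l; lra|].
        unfold K1. nra.
    + assert (Hrc : 1 <= Rpower r0 c * Rpower r (- c)).
      { unfold Rpower. rewrite <- exp_plus, <- exp_0. apply exp_le_compat.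
        assert (ln r <= ln r0) by (apply ln_le; lra). nra. }
      assert (Hfin : m1 + m2 <= (K1 + (m1 + m2) * Rpower r0 c) * Rpower r (- c)) by nra.
      specialize (Hx2 r Hr). pose proof (Rle_abs x2).
      assert (HE1 : exp (X r) <= E0) by (apply exp_le_compat; unfold X0; lra).
      assert (HE2 : exp (q * X r) <= E0).
      { apply exp_le_compat. apply Rle_trans with (q * X0).
        - apply Rmult_le_compat_l; [unfold q; lra | unfold X0; lra].
        - assert (q <= 1) by (unfold q; lra). assert (0 <= X0) by (unfold X0; lra). nra. }
      pose proof (exp_pos (X r)). pose proof (exp_pos (q * X r)).
      pose proof (W_pos r Hr). pose proof (W_le r Hr).
      split.
      * apply Rle_trans with (m1 + m2); [|exact Hfin]. apply Rabs_le. unfold m1 in *. lra.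
      * apply Rle_trans with (m1 + m2); [|exact Hfin].
        assert (0 <= W r * exp (q * X r) <= 2 * INR d * E0).
        { split; [apply Rmult_le_pos; lra | apply Rmult_le_compat; lra]. }
        assert (0 <= gamma * (W r * exp (q * X r)) <= gamma * (2 * INR d * E0)).
        { split; [apply Rmult_le_pos; lra | apply Rmult_le_compat_l; lra]. }
        apply Rabs_le. unfold m2 in *. lra.
Qed.

End Asymptotics.

Theorem mainTheorem13 (d : nat) (gamma rho0 : R) (Rg : Rbar) (rho : R -> R) :
  (3 <= d)%nat ->
  1 <= gamma -> gamma < 2 * INR d / (INR d + 2) ->
  0 < rho0 ->
  LE_profile d gamma rho0 Rg rho ->
  Rg = p_infty /\
  exists c K : R, 0 < c /\ 0 < K /\
    forall r : R, 0 < r ->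
      Rabs (Rpower r (2 / (2 - gamma)) * rho r - v1star d gamma) <= K * Rpower r (- c) /\
      Rabs (Rpower r (2 / (2 - gamma) - INR d) * mass d rho r - v2star d gamma)
        <= K * Rpower r (- c).
Proof.
  intros Hd Hg Hg2 Hr0 Hprof.
  assert (HRg : Rg = p_infty) by (apply (profile_global d gamma rho0 Rg rho); assumption).
  split; [exact HRg|]. destruct Hprof as [Hsol _]. rewrite HRg in Hsol.
  apply (profile_rate d gamma rho0 rho); assumption.
Qed.
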